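(* Let $A$ be a unital AF-algebra and let $\varphi_u,\varphi_v:\mathcal{C}(\mathbb{T})\to A$ be unital $^*$-homomorphisms. If $\mathrm{Cu}(\varphi_u)=\mathrm{Cu}(\varphi_v)$, then $\varphi_u$ and $\varphi_v$ are approximately unitarily equivalent.
   Context: For a $C^*$-algebra $A$, $\mathrm{Cu}(A)$ is the (complete) Cuntz semigroup, i.e. the set of Cuntz equivalence classes of positive elements of $A\otimes\mathcal{K}$ with its usual addition and order; a $^*$-homomorphism $\varphi:A\to B$ induces $\mathrm{Cu}(\varphi):\mathrm{Cu}(A)\to\mathrm{Cu}(B)$, $[a]\mapsto[(\varphi\otimes\mathrm{id}_{\mathcal K})(a)]$. Unital $^*$-homomorphisms $\mathcal{C}(\mathbb{T})\to A$ correspond bijectively to unitaries $u\in A$ via $\varphi_u(f)=f(u)$ (functional calculus). Two $^*$-homomorphisms $\phi,\psi:B\to A$ with $A$ unital are approximately unitarily equivalent if there is a sequence $(w_n)_n$ of unitaries of $A$ such that $\|w_n\phi(x)w_n^*-\psi(x)\|\to0$ for all $x\in B$. *)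

(* Defs.v *)
From HB Require Import structures.
From mathcomp Require Import all_boot all_order all_algebra.
From mathcomp Require Import complex ring lra.
From mathcomp Require Import all_classical all_reals all_analysis.

Set Implicit Arguments.
Unset Strict Implicit.
Unset Printing Implicit Defensive.

Import Order.TTheory GRing.Theory Num.Theory.
Import numFieldNormedType.Exports.
Import Normc.

Local Open Scope classical_set_scope.
Local Open Scope complex_scope.
Local Open Scope ring_scope.

HB.instance Definition _ (R : realType) := NormedModule.copy R[i] R[i]^o.

(* Unital C*-algebras.  In this version of MathComp a new structure cannot     *)
(* inherit from both a possibly trivial ring and a (normed) module, so scaling   *)
(* and norm are fields here; the module structures are attached just below.      *)
(* [1 = 0] is allowed: the zero algebra is a unital C*-algebra.                 *)
HB.mixin Record isCStarAlgebra (R : realType) A of GRing.PzRing A := {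
  cscale : R[i] -> A -> A;
  cscaleA : forall a b x, cscale a (cscale b x) = cscale (a * b) x;
  cscale1 : left_id 1 cscale;
  cscaleDr : right_distributive cscale +%R;
  cscaleDl : forall x, {morph cscale^~ x : a b / a + b};
  cscaleAl : forall a x y, cscale a (x * y) = cscale a x * y;
  cscaleAr : forall a x y, cscale a (x * y) = x * cscale a y;
  star : A -> A;
  starK : involutive star;
  starD : {morph star : x y / x + y};
  starM : forall x y, star (x * y) = star y * star x;
  starZ : forall a x, star (cscale a x) = cscale a^* (star x);
  cnorm : A -> R;
  cnorm_eq0 : forall x, cnorm x = 0 -> x = 0;
  cnormD : forall x y, cnorm (x + y) <= cnorm x + cnorm y;
  cnormZ : forall a x, cnorm (cscale a x) = normc a * cnorm x;
  cnormM : forall x y, cnorm (x * y) <= cnorm x * cnorm y;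
  cnorm_starM : forall x, cnorm (star x * x) = cnorm x ^+ 2;
  cnorm_complete : forall u : nat -> A,
    (forall e : R, 0 < e -> exists N, forall m n, (N <= m)%N -> (N <= n)%N ->
       cnorm (u m - u n) < e) ->
    exists l : A, cnorm (u n - l) @[n --> \oo] --> (0 : R)
}.

#[short(type="cstarAlgType")]
HB.structure Definition CStarAlgebra (R : realType) :=
  {A of GRing.PzRing A & isCStarAlgebra R A}.

Section CStarNormedModule.
Variables (R : realType) (A : cstarAlgType R).

#[export, non_forgetful_inheritance]
HB.instance Definition _ := GRing.Zmodule_isLmodule.Build R[i] (A : Type)
  (@cscaleA R A) (@cscale1 R A) (@cscaleDr R A) (@cscaleDl R A).

Let cnormDC (x y : A) :
  (cnorm (x + y))%:C <= (cnorm x)%:C + (cnorm y)%:C :> R[i].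
Proof. by rewrite -rmorphD lecR cnormD. Qed.

Let cnormZC (a : R[i]) (x : A) : (cnorm (a *: x))%:C = `|a| * (cnorm x)%:C.
Proof. by rewrite [cnorm _]cnormZ rmorphM. Qed.

Let cnorm_eq0C (x : A) : (cnorm x)%:C = 0 -> x = 0.
Proof. by move=> /complexI; exact: cnorm_eq0. Qed.

#[export, non_forgetful_inheritance]
HB.instance Definition _ := Lmodule_isNormed.Build R[i] (A : Type)
  cnormDC cnormZC cnorm_eq0C.

End CStarNormedModule.

(* [{rmorphism B -> A}] already includes preservation of the unit. *)
Record unital_starhom (R : realType) (B A : cstarAlgType R) := UnitalStarHom {
  starhom_rmorphism :> {rmorphism B -> A};
  starhomZ : scalable starhom_rmorphism;
  starhom_star : {morph starhom_rmorphism : x / star x}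
}.

Section Circle.
Variable R : realType.

Definition circle : set R[i] := [set z | `|z| = 1].

Definition cts : {pred (circle -> R[i])} := fun f => `[< continuous f >].

Record C_circle := MkC_circle { C_fun :> circle -> R[i]; _ : C_fun \in cts }.

Lemma C_continuous (f : C_circle) : continuous f.
Proof. by case: f => f /= /asboolP. Qed.

Lemma C_eq (f g : C_circle) : (forall z, f z = g z) -> f = g.
Proof.
case: f g => [f cf] [g cg] /= fg.
have {}fg : f = g by exact/funext.
by case: _ / fg cg => cg; congr MkC_circle; exact: bool_irrelevance.
Qed.

Lemma cts_subring : subring_closed cts.
Proof.
split.
- by apply/asboolP; exact: (@cst_continuous _ _ (1 : R[i])).
- move=> f g /asboolP cf /asboolP cg; apply/asboolP => x.
  exact: (cvgB (cf x) (cg x)).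
- move=> f g /asboolP cf /asboolP cg; apply/asboolP => x.
  exact: (cvgM (cf x) (cg x)).
Qed.

HB.instance Definition _ := [isSub of C_circle for C_fun].
HB.instance Definition _ := [Choice of C_circle by <:].
HB.instance Definition _ :=
  GRing.SubChoice_isSubPzRing.Build _ _ C_circle cts_subring.

Lemma normcE (z : R[i]) : `|z| = (normc z)%:C. Proof. by []. Qed.

Lemma normc_ge0 (z : R[i]) : 0 <= normc z.
Proof. by rewrite -ler0c -normcE normr_ge0. Qed.

Lemma normcJE (z : R[i]) : normc z^* = normc z.
Proof. by apply: complexI; rewrite -!normcE normcJ. Qed.

Lemma normc_triangle (x y : R[i]) : normc (x + y) <= normc x + normc y.
Proof. by rewrite -lecR rmorphD -!normcE ler_normD. Qed.

Lemma normcBC (x y : R[i]) : normc (x - y) = normc (y - x).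
Proof. by apply: complexI; rewrite -!normcE distrC. Qed.

Lemma normc_dist (x y : R[i]) : `|normc x - normc y| <= normc (x - y).
Proof.
have h (a b : R[i]) : normc a - normc b <= normc (a - b).
  by rewrite lerBlDr; have := normc_triangle (a - b) b; rewrite subrK.
by rewrite ler_norml h lerNl opprB normcBC h.
Qed.

Let ReB (x y : R[i]) : complex.Re (x - y) = complex.Re x - complex.Re y.
Proof. by case: x y => [a b] [c d]. Qed.

Let ImB (x y : R[i]) : complex.Im (x - y) = complex.Im x - complex.Im y.
Proof. by case: x y => [a b] [c d]. Qed.

Lemma normc_Re (z : R[i]) : `|complex.Re z| <= normc z.
Proof. by rewrite -lecR; exact: normc_ge_Re. Qed.

Lemma normc_Im (z : R[i]) : `|complex.Im z| <= normc z.
Proof.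
case: z => a b; rewrite /= -sqrtr_sqr ler_sqrt ?addr_ge0 ?sqr_ge0//.
by rewrite lerDr sqr_ge0.
Qed.

Lemma normc_ReIm (a b : R) : normc (a +i* b) <= `|a| + `|b|.
Proof.
have -> : a +i* b = a%:C + 0 +i* b by apply/eqP; rewrite eq_complex /= addr0 add0r !eqxx.
apply: (le_trans (normc_triangle _ _)).
by rewrite /= expr0n /= addr0 add0r !sqrtr_sqr.
Qed.

Let ltr0c (k : R) : (0 < k%:C :> R[i]) = (0 < k).
Proof. by rewrite -[0 in LHS]/(0%:C) ltcR. Qed.

Lemma cvgcP (T : Type) (F : set_system T) (FF : Filter F) (f : T -> R[i]) (z : R[i]) :
  f @ F --> z <-> forall e : R, 0 < e -> \forall x \near F, normc (z - f x) < e.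
Proof.
split=> [/cvgrPdist_lt fz e e0|h].
  have /fz : 0 < e%:C :> R[i] by rewrite ltr0c.
  by apply: filterS => x; rewrite normcE ltcR.
apply/cvgrPdist_lt => e e0.
have eE : e = (complex.Re e)%:C by rewrite RRe_real// gtr0_real.
have /h : 0 < complex.Re e by rewrite -ltr0c -eE.
by apply: filterS => x; rewrite normcE eE ltcR.
Qed.

Lemma cauchy_real (u : nat -> R) :
  (forall e : R, 0 < e -> exists N, forall m n, (N <= m)%N -> (N <= n)%N ->
     `|u m - u n| < e) ->
  exists l : R, u @ \oo --> l.
Proof.
move=> h; have : cvg (u @ \oo).
  apply: R_complete; apply/cauchyP => e e0; have [N hN] := h _ e0.
  by exists (u N); by exists N => // n /= Nn; exact: hN.
by move=> /cvg_ex[l]; exists l.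
Qed.

Let expi (t : R) : circle.
Proof.
exists (cos t +i* sin t); apply/mem_set.
by rewrite /circle /= normc_def /= cos2Dsin2 sqrtr1.
Defined.

Lemma expi_continuous : continuous expi.
Proof.
apply: continuous_comp_initial => t; apply/cvgcP => e e0 /=.
have e2 : 0 < e / 2 by rewrite divr_gt0.
have /cvgrPdist_lt /(_ _ e2) hc := @continuous_cos R t.
have /cvgrPdist_lt /(_ _ e2) hs := @continuous_sin R t.
near=> s.
apply: (@le_lt_trans _ _ (`|cos t - cos s| + `|sin t - sin s|)).
  exact: normc_ReIm.
rewrite (splitr e) ltrD//.
  by near: s; exact: hc.
by near: s; exact: hs.
Unshelve. all: by end_near. Qed.

Lemma expi_surj (z : circle) : exists2 t, t \in `[- pi, pi] & expi t = z.
Proof.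
case: z => -[x y] zc; have /set_mem := zc; rewrite /circle /= normc_def /=.
move=> -[/(congr1 (fun r => r ^+ 2))].
rewrite sqr_sqrtr ?addr_ge0 ?sqr_ge0// expr1n => xy1.
have x11 : -1 <= x <= 1.
  by rewrite -ler_norml -(ler_pXn2r (ltn0Sn 1)) ?nnegrE// expr1n real_normK
    ?num_real// -xy1 lerDl sqr_ge0.
have [/andP[a0 api] ca] := acos_def x11.
have sa := sin_acos x11.
have sy : Num.sqrt (1 - x ^+ 2) = `|y|.
  by rewrite -xy1 addrAC subrr add0r sqrtr_sqr.
have [y0|y0] := leP 0 y.
  exists (acos x); first by rewrite in_itv /= api (le_trans _ a0)// oppr_le0 pi_ge0.
  apply: val_inj => /=; rewrite ca sa; congr (_ +i* _).
  by rewrite [LHS]sy ger0_norm.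
exists (- acos x).
  by rewrite in_itv /= lerN2 api /= (le_trans _ (pi_ge0 R))// oppr_le0.
apply: val_inj => /=; rewrite cosN sinN ca sa; congr (_ +i* _).
by rewrite [X in - X]sy ltr0_norm// opprK.
Qed.

Let one_circle : circle := expi 0.

Definition C_norm (f : C_circle) : R := sup (range (fun z => normc (f z))).

Lemma C_norm_has_sup (f : C_circle) : has_sup (range (fun z => normc (f z))).
Proof.
split; first by exists (normc (f one_circle)), one_circle.
have : exists2 c, c \in `[- pi, pi] & forall t, t \in `[- pi, pi] ->
    normc (f (expi t)) <= normc (f (expi c)).
  apply: EVT_max; first by rewrite (le_trans _ (pi_ge0 R))// oppr_le0 pi_ge0.
  apply: continuous_subspaceT => t; apply/cvgrPdist_lt => e e0.
  have := continuous_comp (@expi_continuous t) (@C_continuous f (expi t)).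
  move=> /cvgcP /(_ e e0); apply: filterS => s /=.
  exact: le_lt_trans (normc_dist _ _).
move=> [c _ h]; exists (normc (f (expi c))) => _ [z _ <-].
by have [t tpi <-] := expi_surj z; exact: h.
Qed.

Lemma C_norm_ub (f : C_circle) z : normc (f z) <= C_norm f.
Proof. by apply: (sup_upper_bound (C_norm_has_sup f)); exists z. Qed.

Lemma C_norm_le (f : C_circle) c : (forall z, normc (f z) <= c) -> C_norm f <= c.
Proof.
move=> h; apply: ge_sup; first by have [] := C_norm_has_sup f.
by move=> _ [z _ <-].
Qed.

Lemma C_norm_ge0 f : 0 <= C_norm f.
Proof. exact: le_trans (normc_ge0 _) (C_norm_ub f one_circle). Qed.

Lemma C_scale_cts (a : R[i]) (f : C_circle) : (fun z => a * f z) \in cts.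
Proof.
apply/asboolP => x.
exact: (cvgM (@cst_continuous _ _ a _) (@C_continuous f x)).
Qed.

Lemma C_star_cts (f : C_circle) : (fun z => (f z)^*) \in cts.
Proof.
apply/asboolP => x; apply/(@cvgcP _ _ (nbhs_filter x)) => e e0.
have /(@cvgcP _ _ (nbhs_filter x)) /(_ e e0) := @C_continuous f x.
by apply: (@filterS _ _ (nbhs_filter x)) => y; rewrite -raddfB normcJE.
Qed.

Definition C_scale a f := MkC_circle (C_scale_cts a f).
Definition C_star f := MkC_circle (C_star_cts f).

Let C_scaleA a b f : C_scale a (C_scale b f) = C_scale (a * b) f.
Proof. by apply: C_eq => z /=; rewrite mulrA. Qed.
Let C_scale1 : left_id 1 C_scale.
Proof. by move=> f; apply: C_eq => z /=; rewrite mul1r. Qed.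
Let C_scaleDr : right_distributive C_scale +%R.
Proof. by move=> a f g; apply: C_eq => z; exact: mulrDr. Qed.
Let C_scaleDl f : {morph C_scale^~ f : a b / a + b}.
Proof. by move=> a b; apply: C_eq => z; exact: mulrDl. Qed.
Let C_scaleAl a f g : C_scale a (f * g) = C_scale a f * g.
Proof. by apply: C_eq => z; exact: mulrA. Qed.
Let C_scaleAr a f g : C_scale a (f * g) = f * C_scale a g.
Proof. by apply: C_eq => z; exact: mulrCA. Qed.
Let C_starK : involutive C_star.
Proof. by move=> f; apply: C_eq => z; exact: conjcK. Qed.
Let C_starD : {morph C_star : f g / f + g}.
Proof. by move=> f g; apply: C_eq => z; exact: (raddfD (@conjc R)). Qed.
Let C_starM f g : C_star (f * g) = C_star g * C_star f.
Proof.
apply: C_eq => z; rewrite [RHS]mulrC.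
exact: (rmorphM (@conjc R) (f z) (g z)).
Qed.
Let C_starZ a f : C_star (C_scale a f) = C_scale a^* (C_star f).
Proof. by apply: C_eq => z; exact: (rmorphM (@conjc R) a (f z)). Qed.

Let C_norm_eq0 f : C_norm f = 0 -> f = 0.
Proof.
move=> f0; apply: C_eq => z; apply: eq0_normc.
by apply/eqP; rewrite eq_le normc_ge0 -{1}f0 C_norm_ub.
Qed.

Let C_normD f g : C_norm (f + g) <= C_norm f + C_norm g.
Proof.
apply: C_norm_le => z; apply: (le_trans (normc_triangle (f z) (g z))).
by rewrite lerD// C_norm_ub.
Qed.

Let C_normZ_le a f : C_norm (C_scale a f) <= normc a * C_norm f.
Proof.
by apply: C_norm_le => z; rewrite /= normcM ler_wpM2l ?normc_ge0// C_norm_ub.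
Qed.

Let C_normZ a f : C_norm (C_scale a f) = normc a * C_norm f.
Proof.
apply/eqP; rewrite eq_le C_normZ_le /=.
have [->|a0] := eqVneq a 0; first by rewrite normc0 mul0r C_norm_ge0.
have na0 : 0 < normc a.
  rewrite lt_def normc_ge0 andbT; apply: contra a0 => /eqP /eq0_normc ->.
  exact: eqxx.
rewrite mulrC -ler_pdivlMr// mulrC -normcV.
rewrite -{1}[f]C_scale1 -(mulVf a0) -C_scaleA; exact: C_normZ_le.
Qed.

Let C_normM f g : C_norm (f * g) <= C_norm f * C_norm g.
Proof.
apply: C_norm_le => z; rewrite [normc _](normcM (f z) (g z)).
by rewrite ler_pM ?normc_ge0// C_norm_ub.
Qed.

Let C_norm_starM f : C_norm (C_star f * f) = C_norm f ^+ 2.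
Proof.
have E z : normc ((C_star f * f) z) = normc (f z) ^+ 2.
  by rewrite [LHS](normcM (f z)^* (f z)) normcJE.
apply/eqP; rewrite eq_le; apply/andP; split.
  by apply: C_norm_le => z; rewrite E ler_pXn2r ?nnegrE ?normc_ge0 ?C_norm_ge0
    ?C_norm_ub.
have h : C_norm f <= Num.sqrt (C_norm (C_star f * f)).
  apply: C_norm_le => z; rewrite -(ler_pXn2r (ltn0Sn 1)) ?nnegrE ?normc_ge0
    ?sqrtr_ge0// sqr_sqrtr ?C_norm_ge0// -E; exact: C_norm_ub.
rewrite -[leRHS]sqr_sqrtr ?C_norm_ge0//.
by rewrite ler_pXn2r ?nnegrE ?C_norm_ge0 ?sqrtr_ge0.
Qed.

Let C_norm_complete (u : nat -> C_circle) :
  (forall e : R, 0 < e -> exists N, forall m n, (N <= m)%N -> (N <= n)%N ->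
     C_norm (u m - u n) < e) ->
  exists l, C_norm (u n - l) @[n --> \oo] --> (0 : R).
Proof.
move=> uC.
have dist m n z : normc (u m z - u n z) <= C_norm (u m - u n).
  exact: (C_norm_ub (u m - u n) z).
have limRe z : exists l : R, (fun n => complex.Re (u n z)) @ \oo --> l.
  apply: cauchy_real => e e0; have [N hN] := uC _ e0.
  exists N => m n Nm Nn; apply: le_lt_trans (hN _ _ Nm Nn).
  by rewrite -ReB; exact: le_trans (normc_Re _) (dist m n z).
have limIm z : exists l : R, (fun n => complex.Im (u n z)) @ \oo --> l.
  apply: cauchy_real => e e0; have [N hN] := uC _ e0.
  exists N => m n Nm Nn; apply: le_lt_trans (hN _ _ Nm Nn).
  by rewrite -ImB; exact: le_trans (normc_Im _) (dist m n z).
have limC z : exists l : R[i], (fun n => u n z) @ \oo --> l.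
  have [[a ha] [b hb]] := (limRe z, limIm z).
  exists (a +i* b); apply/cvgcP => e e0; have e2 : 0 < e / 2 by rewrite divr_gt0.
  move: ha hb => /cvgrPdist_lt /(_ _ e2) ha /cvgrPdist_lt /(_ _ e2) hb.
  near=> n; have -> : a +i* b - u n z = (a - complex.Re (u n z)) +i* (b - complex.Im (u n z)).
    by case: (u n z).
  apply: (le_lt_trans (normc_ReIm _ _)); rewrite (splitr e) ltrD//.
    by near: n; exact: ha.
  by near: n; exact: hb.
have [g gu] := choice limC.
have unif e : 0 < e -> exists N, forall n z, (N <= n)%N ->
    normc (u n z - g z) <= e.
  move=> e0; have e2 : 0 < e / 2 by rewrite divr_gt0.
  have [N hN] := uC _ e2; exists N => n z Nn.
  have /cvgcP /(_ _ e2) := gu z; move=> [M _ hM].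
  pose m := maxn N M.
  have -> : u n z - g z = (u n z - u m z) + (u m z - g z).
    by rewrite addrA subrK.
  apply: (le_trans (normc_triangle _ _)); rewrite (splitr e) lerD//.
    by apply: le_trans (dist _ _ _) (ltW (hN _ _ Nn _)); rewrite leq_maxl.
  by rewrite normcBC; apply/ltW/hM; rewrite /= leq_maxr.
have gc : g \in cts.
  apply/asboolP => z; apply/(@cvgcP _ _ (nbhs_filter z)) => e e0.
  have e3 : 0 < e / 3 by rewrite divr_gt0.
  have [N hN] := unif _ e3.
  have /(@cvgcP _ _ (nbhs_filter z)) /(_ _ e3) := @C_continuous (u N) z.
  apply: (@filterS _ _ (nbhs_filter z)) => y h.
  have -> : g z - g y = (g z - u N z) + ((u N z - u N y) + (u N y - g y)).
    by ring.
  apply: (le_lt_trans (normc_triangle _ _)).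
  apply: (le_lt_trans (lerD (lexx _) (normc_triangle _ _))).
  have -> : e = e / 3 + (e / 3 + e / 3) by field.
  rewrite ler_ltD// ?ltr_leD// ?hN//.
  by rewrite normcBC hN.
exists (MkC_circle gc); apply/cvgrPdist_le => e e0.
have [N hN] := unif _ e0; exists N => // n /= Nn.
rewrite sub0r normrN ger0_norm ?C_norm_ge0//.
by apply: C_norm_le => z; exact: hN.
Unshelve. all: by end_near. Qed.

HB.instance Definition _ := isCStarAlgebra.Build R C_circle
  C_scaleA C_scale1 C_scaleDr C_scaleDl C_scaleAl C_scaleAr
  C_starK C_starD C_starM C_starZ
  C_norm_eq0 C_normD C_normZ C_normM C_norm_starM C_norm_complete.

End Circle.

Section CuntzSemigroup.
Variables (R : realType) (A : cstarAlgType R).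

Definition infmx := nat -> nat -> A.
Implicit Types a b x y : infmx.

(* The norm of the Hilbert module A^n, with inner product sum_i x_i^* y_i. *)
Definition col_norm n (x : 'cV[A]_n) : R :=
  Num.sqrt (cnorm (\sum_(i < n) star (x i ord0) * x i ord0)).

(* The C*-norm of M_n(A): the operator norm of its action on A^n. *)
Definition mx_norm n (M : 'M[A]_n) : \bar R :=
  ereal_sup [set (col_norm (M *m x))%:E | x in [set x | col_norm x <= 1]].

Definition stab_norm a : \bar R :=
  ereal_sup (range (fun n => mx_norm (\matrix_(i < n, j < n) a i j))).

Definition corner n a : infmx :=
  fun i j => if (i < n)%N && (j < n)%N then a i j else 0.

(* A (x) K, realized as the completion of the increasing union of the M_n(A): *)
(* an element is an infinite matrix that is the norm limit of its corners.     *)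
Definition stab : set infmx :=
  [set a | stab_norm (a - corner n a) @[n --> \oo] --> 0%E].

Definition stab_mul a b : infmx :=
  fun i j => limn (fun n => \sum_(k < n) a i k * b k j).

Definition stab_star a : infmx := fun i j => star (a j i).

Definition stab_pos : set infmx := [set stab_mul (stab_star x) x | x in stab].

Definition cuntz_le a b := exists r : nat -> infmx,
  (forall n, stab (r n)) /\
  stab_norm (stab_mul (stab_mul (r n) b) (stab_star (r n)) - a)
    @[n --> \oo] --> 0%E.

Definition cuntz_eq a b := cuntz_le a b /\ cuntz_le b a.

Definition Cu_class a : set infmx := [set b | stab_pos b /\ cuntz_eq a b].

Definition Cu : set (set infmx) := [set Cu_class a | a in stab_pos].

End CuntzSemigroup.

Section CuntzMap.
Variables (R : realType) (B A : cstarAlgType R) (phi : unital_starhom B A).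

(* phi (x) id_K acts entrywise. *)
Definition stab_map (a : infmx B) : infmx A := fun i j => phi (a i j).

(* Cu(phi) : Cu(B) -> Cu(A) sends [a] to [(phi (x) id_K)(a)]; it is given here   *)
(* as a function of the representative a, so that Cu(phi) = Cu(psi) reads        *)
(* [forall a, stab_pos a -> Cu_map phi a = Cu_map psi a].                        *)
Definition Cu_map (a : infmx B) : set (infmx A) := Cu_class (stab_map a).

End CuntzMap.

Section AF.
Variables (R : realType) (A : cstarAlgType R).

Definition star_subalgebra (B : set A) :=
  [/\ B 0, forall x y, B x -> B y -> B (x + y),
      forall (c : R[i]) x, B x -> B (c *: x),
      forall x y, B x -> B y -> B (x * y)
    & forall x, B x -> B (star x)].

Definition fin_dim (B : set A) := exists s : seq A,
  B = [set x | exists c : 'I_(size s) -> R[i], x = \sum_(i < size s) c i *: s`_i].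

Definition AF_algebra := exists B : nat -> set A,
  [/\ forall n, star_subalgebra (B n) /\ fin_dim (B n),
      forall n, B n `<=` B n.+1
    & closure (\bigcup_n B n) = [set: A]].

Definition unitary (w : A) := star w * w = 1 /\ w * star w = 1.

End AF.

Definition approx_unitarily_equivalent (R : realType) (B A : cstarAlgType R)
    (phi psi : unital_starhom B A) := exists w : nat -> A,
  (forall n, unitary (w n)) /\
  forall x, cnorm (w n * phi x * star (w n) - psi x) @[n --> \oo] --> (0 : R).

(* Main.v *)
(* By the AF hypothesis the two unitaries, and the elements that implement finitely many Cuntz
   comparisons, can be moved into one finite-dimensional C*-subalgebra B containing 1.  There both
   unitaries are diagonal: u = sum_i l_i e_i and v = sum_j m_j f_j, with e_i and f_j minimal
   projections of B with sum 1.  Fix a finite net of the circle.  For a function g that is 1 on a set S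
   of eigenvalues of u and vanishes far from S, the Cuntz comparison g(u) <= g(v) gives r with
   |r g(v) r^* - g(u)| < 1, and linear algebra in each Murray-von Neumann class of minimal projections
   bounds the number of eigenvalues of u in S by the number of eigenvalues of v near S.  This is Hall's
   condition, so the e_i are matched with equivalent f_j with nearby eigenvalues, and the sum of the
   partial isometries e_i -> f_j is a unitary that conjugates u to an element close to v.
   The *-homomorphisms f |-> f(u) are contractive, since h + i sqrt(1 - h^2) is unitary for
   -1 <= h <= 1, and every continuous function on the circle is a uniform limit of rational functions
   of z and its conjugate; hence f(u) depends continuously on u. *)
From mathcomp Require Import all_boot all_order all_algebra.
From mathcomp Require Import complex ring lra zify.
From mathcomp Require Import all_classical all_reals all_analysis.
Require Import Defs.

Set Implicit Arguments.
Unset Strict Implicit.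
Unset Printing Implicit Defensive.

Import Order.TTheory GRing.Theory Num.Theory.
Import numFieldNormedType.Exports.
Import Normc.

Local Open Scope classical_set_scope.
Local Open Scope complex_scope.
Local Open Scope ring_scope.

(** * C*-algebra calculus *)

Section CStarBasics.
Variables (R : realType) (A : cstarAlgType R).
Implicit Types (x y : A) (a b : R[i]).

(** The order of choices shapes the proof. Hall's condition concerns sets of eigenvalues that exist
    only once B is chosen, while the elements r that implement the Cuntz comparisons have to be
    moved into B and so must be known earlier. Hence bump functions and their r are fixed in advance
    for all of the finitely many subsets of the net, and a set of eigenvalues is later replaced by
    the set of net points near it. All tolerances depend on the norms of these r, so they too are
    fixed before B. Positivity enters through norms: the C*-identity, unitaries averaging to a
    self-adjoint element, and the norm 1 of a nonzero projection. Spectral theory inside B is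
    Lagrange interpolation at the roots of an annihilating polynomial, and the block structure of B
    is seen through the equality e B e = C e for minimal projections e. From the stabilization only
    the entry at (0,0) is read off, which turns each comparison into a statement inside A. *)

Lemma cscalerAl a x y : a *: (x * y) = (a *: x) * y.
Proof. exact: cscaleAl. Qed.

Lemma cscalerAr a x y : a *: (x * y) = x * (a *: y).
Proof. exact: cscaleAr. Qed.

Lemma starS a x : star (a *: x) = a^* *: star x.
Proof. exact: starZ. Qed.

Lemma starSR (r : R) x : star (r%:C *: x) = r%:C *: star x.
Proof. by rewrite starS; congr (_ *: _); exact: conjc_real. Qed.

Lemma star0 : star (0 : A) = 0.
Proof. by apply: (addrI (star (0 : A))); rewrite -starD !addr0. Qed.

Lemma starN x : star (- x) = - star x.
Proof. by apply: (addrI (star x)); rewrite -starD !subrr star0. Qed.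

Lemma starB x y : star (x - y) = star x - star y.
Proof. by rewrite starD starN. Qed.

Lemma star1 : star (1 : A) = 1.
Proof. by have := starM (star (1 : A)) 1; rewrite starK !mulr1 starK. Qed.

Lemma star_sum (I : Type) (r : seq I) (P : pred I) (F : I -> A) :
  star (\sum_(i <- r | P i) F i) = \sum_(i <- r | P i) star (F i).
Proof. by elim/big_rec2: _ => [|i x y _ <-]; rewrite ?star0 ?starD. Qed.

Lemma starX x n : star (x ^+ n) = star x ^+ n.
Proof. by elim: n => [|n IH]; rewrite ?expr0 ?star1// exprS starM IH exprSr. Qed.

Lemma cnormS a x : cnorm (a *: x) = normc a * cnorm x.
Proof. exact: cnormZ. Qed.

Lemma normc_real (r : R) : normc r%:C = `|r|.
Proof. by rewrite /= expr0n /= addr0 sqrtr_sqr. Qed.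

Lemma normcN1 : normc (-1 : R[i]) = 1.
Proof. by rewrite normcN normc1. Qed.

Lemma cnorm0 : cnorm (0 : A) = 0.
Proof. by rewrite -[0 in LHS](scale0r (0 : A)) cnormS normc0 mul0r. Qed.

Lemma cnormN x : cnorm (- x) = cnorm x.
Proof. by rewrite -scaleN1r cnormS normcN1 mul1r. Qed.

Lemma cnorm_ge0 x : 0 <= cnorm x.
Proof.
have := cnormD x (- x); rewrite subrr cnorm0 cnormN -mulr2n.
by rewrite pmulrn_lge0.
Qed.

Lemma cnormBC x y : cnorm (x - y) = cnorm (y - x).
Proof. by rewrite -opprB cnormN. Qed.

Lemma cnorm_tri x y z : cnorm (x - z) <= cnorm (x - y) + cnorm (y - z).
Proof. by have := cnormD (x - y) (y - z); rewrite addrA subrK. Qed.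

Lemma cnorm_star_le x : cnorm x <= cnorm (star x).
Proof.
have [->|x0] := eqVneq (cnorm x) 0; first exact: cnorm_ge0.
have xp : 0 < cnorm x by rewrite lt_def x0 cnorm_ge0.
by rewrite -(ler_pM2r xp) -expr2 -cnorm_starM cnormM.
Qed.

Lemma cnorm_star x : cnorm (star x) = cnorm x.
Proof.
by apply/eqP; rewrite eq_le cnorm_star_le andbT -{2}[x]starK cnorm_star_le.
Qed.

Lemma cnorm_starM' x : cnorm (x * star x) = cnorm x ^+ 2.
Proof. by rewrite -{1}[x]starK cnorm_starM cnorm_star. Qed.

(** The C*-identity makes the norm of 1 its own square; the value 0 occurs in the zero algebra,
    hence an inequality. *)
Lemma cnorm1_le : cnorm (1 : A) <= 1.
Proof.
have := cnorm_starM (1 : A); rewrite star1 mulr1 => e.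
have [->|x0] := eqVneq (cnorm (1 : A)) 0; first exact: ler01.
by rewrite -[leRHS](mulfV x0) -{1}[cnorm 1](mulfK x0) -expr2 -e mulfV.
Qed.

Lemma cnorm_isometry x : star x * x = 1 -> cnorm x <= 1.
Proof.
move=> h; rewrite -(ler_pXn2r (ltn0Sn 1)) ?nnegrE ?cnorm_ge0// expr1n.
by rewrite -cnorm_starM h cnorm1_le.
Qed.

Lemma cnorm_unitary_mul x y : unitary x -> cnorm (x * y * star x) <= cnorm y.
Proof.
move=> [h _]; have n1 := cnorm_isometry h.
apply: le_trans (cnormM _ _) _; rewrite cnorm_star.
rewrite -[leRHS]mulr1 ler_pM ?cnorm_ge0//.
by apply: le_trans (cnormM _ _) _; rewrite -[leRHS]mul1r ler_pM ?cnorm_ge0.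
Qed.

Lemma cnorm_sa_sq x : star x = x -> cnorm (x * x) = cnorm x ^+ 2.
Proof. by move=> h; rewrite -{1}h cnorm_starM. Qed.

Lemma cnorm_le_sq x (M : R) : 0 <= M -> cnorm (star x * x) <= M ^+ 2 -> cnorm x <= M.
Proof.
by move=> M0; rewrite cnorm_starM ler_pXn2r ?nnegrE ?cnorm_ge0.
Qed.

(* [x] is the mean of the unitaries [x + i y] and [x - i y]. *)
Lemma cnorm_cos_le1 x y : star x = x -> star y = y -> x * y = y * x ->
  x * x + y * y = 1 -> cnorm x <= 1.
Proof.
move=> sx sy xy e.
have I a : a = 'i \/ a = - 'i -> cnorm (x + a *: y) <= 1.
  move=> ha; apply: cnorm_isometry.
  have aJ : a^* = - a by case: ha => ->; apply/eqP; rewrite eq_complex /= ?oppr0 ?opprK !eqxx.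
  have aa : a * a = -1.
    by case: ha => ->; rewrite ?mulrNN -expr2; exact: sqr_i.
  rewrite starD starS sx sy aJ scaleNr mulrBl !mulrDr -!cscalerAl -!cscalerAr.
  rewrite scalerA aa scaleN1r xy -e.
  by rewrite opprD opprK (addrA (_ + _) (- _) (y * y)) addrK.
have := cnormD (x + 'i *: y) (x + (- 'i) *: y).
have -> : x + 'i *: y + (x + - 'i *: y) = (2 : R)%:C *: x.
  rewrite scaleNr addrACA subrr addr0 -mulr2n -scaler_nat; congr (_ *: _).
  by rewrite rmorph_nat.
rewrite cnormS normc_real ger0_norm//.
have h1 := I 'i (or_introl erefl); have h2 := I (- 'i) (or_intror erefl).
move: (cnorm x) (cnorm _) (cnorm _) h1 h2 => p q r; lra.
Qed.

End CStarBasics.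

(** * The circle and its continuous functions *)

Section CircleTopology.
Variable R : realType.
Local Notation T := (@circle R).
Local Notation CT := (C_circle R).

Lemma circle_normc (z : T) : normc (val z) = 1.
Proof. by case: z => z /= /set_mem; rewrite /circle /= normcE => -[]. Qed.

Lemma circle_nbhs (x : T) (P : set T) : nbhs x P ->
  exists2 d : R, 0 < d & forall y, normc (val y - val x) < d -> P y.
Proof.
rewrite nbhsE => -[U [[V oV VU] Ux] UP].
have : nbhs (val x : R[i]) V by apply: open_nbhs_nbhs; split=> //; rewrite -VU in Ux.
move=> /nbhs_ballP[e e0 eV].
have eE : e = (complex.Re e)%:C by rewrite RRe_real// gtr0_real.
exists (complex.Re e); first by rewrite -ltcR -eE.
move=> y yx; apply: UP; rewrite -VU; apply: eV; rewrite -ball_normE /=.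
by rewrite eE distrC normcE ltcR.
Qed.

Lemma val_circle_continuous : continuous (val : T -> R[i]).
Proof. exact: initial_continuous. Qed.

Lemma nbhs_circle (x : T) (d : R) : 0 < d ->
  \forall y \near x, normc (val y - val x) < d.
Proof.
move=> d0; have /(@cvgcP _ _ _ (nbhs_filter x)) /(_ d d0) := @val_circle_continuous x.
by apply: (@filterS _ _ (nbhs_filter x)) => y; rewrite normcBC.
Qed.

Lemma circle_compact : compact [set: T].
Proof.
have [E [cE sE]] : exists E : R -> T,
    continuous E /\ forall z, exists2 t, t \in `[- pi, pi] & E t = z.
  exact: (ex_intro _ _ (conj (@expi_continuous R) (@expi_surj R))).
have -> : [set: T] = E @` `[- pi, pi].
  by apply/seteqP; split=> // z _; have [t tp <-] := sE z; exists t.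
apply: continuous_compact; last exact: segment_compact.
exact: continuous_subspaceT.
Qed.

Lemma circle_net (d : R) : 0 < d ->
  exists s : seq T, forall x : T, exists2 y, y \in s & normc (val x - val y) < d.
Proof.
(* [F] is the filter of finite lists directed by inclusion; near-covering compactness merges the
   one-point lists into a single list for the whole circle. *)
move=> d0; pose F : set_system (seq T) :=
  [set S | exists s0 : seq T, forall s : seq T, {subset s0 <= s} -> S s].
have FF : Filter F.
  split; first by exists [::].
  - move=> P Q [p hp] [q hq]; exists (p ++ q) => s hs.
    by split; [apply: hp|apply: hq] => x xs; apply: hs; rewrite mem_cat xs ?orbT.
  - by move=> P Q PQ [p hp]; exists p => s /hp /PQ.
have := (compact_near_coveringP _).1 circle_compact _ F
  (fun (s : seq T) x => exists2 y, y \in s & normc (val x - val y) < d) FF.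
case.
  move=> x _; exists ([set y | normc (val y - val x) < d], [set s : seq T | x \in s]).
    split; first exact: nbhs_circle.
    by exists [:: x] => s /(_ x); rewrite mem_head => /(_ isT).
  by move=> [y s] /= [yx xs]; exists x.
by move=> s /(_ s (fun _ => id)) h; exists s => x; exact: h.
Qed.

Lemma C_circle_unif (f : CT) (e : R) : 0 < e ->
  exists2 d : R, 0 < d &
    forall x y, normc (val x - val y) < d -> normc (f x - f y) < e.
Proof.
move=> e0; have e2 : 0 < e / 2 by rewrite divr_gt0.
(* With radii tending to 0 from the right as the auxiliary filter, compactness yields one radius for
   all centres. *)
have := (compact_near_coveringP _).1 circle_compact _ (0 : R)^'+
  (fun d x => forall y, normc (val y - val x) < d -> normc (f y - f x) < e)
  (at_right_proper_filter _).
case.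
  move=> x _.
  have /(@cvgcP _ _ _ (nbhs_filter x)) /(_ _ e2) := @C_continuous R f x.
  move=> /circle_nbhs[d d0 hd]; have d2 : 0 < d / 2 by rewrite divr_gt0.
  exists ([set y | normc (val y - val x) < d / 2], [set r | r < d / 2]).
    by split; [exact: nbhs_circle|exact: nbhs_right_lt].
  move=> [x' r] /= [xx' rd] y yx'.
  have fx : normc (f x - f x') < e / 2 by apply: hd; apply: lt_trans xx' _; lra.
  have fy : normc (f x - f y) < e / 2.
    apply: hd; rewrite -(subrKA (val x')); apply: le_lt_trans (normc_triangle _ _) _.
    by rewrite (splitr d) ltrD// (lt_trans yx').
  rewrite -(subrKA (f x)); apply: le_lt_trans (normc_triangle _ _) _.
  by rewrite (splitr e) ltrD// normcBC.
move=> d [d0 hd].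
have d1 : 0 < d / 2 by rewrite divr_gt0.
exists (d / 2) => // x y xy.
apply: (hd (d / 2)) => //=; last first.
rewrite sub0r normrN gtr0_norm//; lra.
Qed.

Definition idC : CT.
Proof. exists (fun z => val z); apply/asboolP; exact: val_circle_continuous. Defined.

Lemma realC_cts (g : T -> R) : continuous g -> (fun z => (g z)%:C) \in @cts R.
Proof.
move=> cg; apply/asboolP => x; apply/(@cvgcP _ _ _ (nbhs_filter x)) => e e0.
have /(@cvgrPdist_lt _ _ _ _ (nbhs_filter x)) /(_ e e0) := cg x.
apply: (@filterS _ _ (nbhs_filter x)) => y.
by rewrite -rmorphB normc_real.
Qed.

Definition realC (g : T -> R) (cg : continuous g) : CT := MkC_circle (realC_cts cg).

Lemma normc_comp_continuous (f : CT) : continuous (fun z => normc (f z)).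
Proof.
move=> x; apply/(@cvgrPdist_lt _ _ _ _ (nbhs_filter x)) => e e0.
have /(@cvgcP _ _ _ (nbhs_filter x)) /(_ e e0) := @C_continuous R f x.
apply: (@filterS _ _ (nbhs_filter x)) => y.
exact: le_lt_trans (normc_dist _ _).
Qed.

End CircleTopology.

(* A predicate on bare functions, so that it also covers conjugates [w * phi x * star w] and the
   evaluations [f |-> sum_i f (l i) *: e i] at finitely many points. *)
Record is_starhom (R : realType) (B A : cstarAlgType R) (phi : B -> A) : Prop := {
  shD : {morph phi : x y / x + y};
  shZ : forall a x, phi (cscale a x) = a *: phi x;
  shM : {morph phi : x y / x * y};
  sh1 : phi 1 = 1;
  shS : {morph phi : x / star x}
}.

Section StarHom.
Variables (R : realType) (A : cstarAlgType R).
Local Notation T := (@circle R).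
Local Notation CT := (C_circle R).
Implicit Types (phi psi : CT -> A) (f g : CT).

Lemma unital_starhomP (B : cstarAlgType R) (phi : unital_starhom B A) : is_starhom phi.
Proof.
split.
- exact: rmorphD.
- by move=> a x; exact: (starhomZ phi).
- exact: rmorphM.
- exact: rmorph1.
- exact: starhom_star.
Qed.

Lemma starhom_conj (B : cstarAlgType R) (phi : B -> A) (w : A) :
  is_starhom phi -> unitary w -> is_starhom (fun x => w * phi x * star w).
Proof.
move=> h [w1 w2]; split=> [x y|a x|x y||x].
- by rewrite (shD h) mulrDr mulrDl.
- by rewrite (shZ h) -cscalerAr -cscalerAl.
- by rewrite (shM h) -!mulrA (mulrA (star w) w) w1 mul1r.
- by rewrite (sh1 h) mulr1.
- by rewrite (shS h) !starM starK mulrA.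
Qed.

Lemma starhom0 phi : is_starhom phi -> phi 0 = 0.
Proof. by move=> h; apply: (addrI (phi 0)); rewrite -(shD h) !addr0. Qed.

Lemma starhomB phi : is_starhom phi -> {morph phi : x y / x - y}.
Proof.
move=> h x y; rewrite (shD h); congr (_ + _).
by apply: (addrI (phi y)); rewrite -(shD h) !subrr (starhom0 h).
Qed.

Lemma C_sumE (I : Type) (r : seq I) (P : pred I) (F : I -> CT) z :
  (\sum_(i <- r | P i) F i) z = \sum_(i <- r | P i) F i z.
Proof.
elim: r => [|i r IH]; first by rewrite !big_nil; reflexivity.
by rewrite !big_cons; case: (P i); rewrite // -IH; reflexivity.
Qed.

Lemma C_expE f n z : (f ^+ n) z = f z ^+ n.
Proof. by elim: n => [|n IH]; [reflexivity|rewrite !exprS -IH; reflexivity]. Qed.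

Lemma circle_pt : T.
Proof. by exists 1; apply/mem_set; rewrite /circle /= normr1. Qed.

Lemma sqr_normc (x : R[i]) : normc x ^+ 2 = complex.Re x ^+ 2 + complex.Im x ^+ 2.
Proof. by case: x => a b /=; rewrite sqr_sqrtr ?addr_ge0 ?sqr_ge0. Qed.

Lemma normc_sqE (x : R[i]) : (normc x ^+ 2)%:C = x^* * x.
Proof.
rewrite sqr_normc; case: x => a b; apply/eqP; rewrite eq_complex /=.
by apply/andP; split; apply/eqP; ring.
Qed.

Lemma starhom_contractive phi f (M : R) : is_starhom phi ->
  (forall z, normc (f z) <= M) -> cnorm (phi f) <= M.
Proof.
move=> hphi fM; have M0 : 0 <= M := le_trans (normc_ge0 _) (fM circle_pt).
have [M00|Mn0] := eqVneq M 0.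
  have -> : f = 0.
    apply: C_eq => z; apply: eq0_normc; apply/eqP.
    by rewrite eq_le normc_ge0 -{1}M00 fM.
  by rewrite (starhom0 hphi) cnorm0.
have Mp : 0 < M by rewrite lt_def Mn0.
(* By the C*-identity it suffices to bound the image of the real function |f|^2 = M^2 h; [h] and [k]
   play the roles of cosine and sine. *)
pose h z := (normc (f z) / M) ^+ 2.
pose k z := Num.sqrt (1 - h z ^+ 2).
have h01 z : 0 <= h z <= 1.
  have n0 : 0 <= normc (f z) / M by rewrite divr_ge0 ?normc_ge0.
  have n1 : normc (f z) / M <= 1 by rewrite ler_pdivrMr// mul1r.
  by rewrite /h sqr_ge0 exprn_ile1.
have ch : continuous h.
  have c1 : continuous (fun z => normc (f z) / M).
    by move=> z; exact: (cvgM (@normc_comp_continuous _ f z) (@cst_continuous _ _ (M^-1) z)).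
  by move=> z; exact: (cvgM (c1 z) (c1 z)).
have ck : continuous k.
  move=> z; apply: (@continuous_comp _ _ _ (fun z => 1 - h z ^+ 2) Num.sqrt); last exact: sqrt_continuous.
  exact: (cvgB (@cst_continuous _ _ (1 : R) z) (cvgM (ch z) (ch z))).
pose H := realC ch; pose K := realC ck.
have sa (g : T -> R) (cg : continuous g) : star (phi (realC cg)) = phi (realC cg).
  rewrite -(shS hphi); congr (phi _); apply: C_eq => z.
  exact: conjc_real.
have HK : H * H + K * K = 1.
  apply: C_eq => z; change ((h z)%:C * (h z)%:C + (k z)%:C * (k z)%:C = 1).
  rewrite -!rmorphM -rmorphD -!expr2 sqr_sqrtr; last first.
    by case/andP: (h01 z) => h0 h1; rewrite subr_ge0 exprn_ile1.
  by rewrite addrC subrK rmorph1.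
have nH : cnorm (phi H) <= 1.
  apply: (@cnorm_cos_le1 _ _ _ (phi K)); rewrite ?sa//.
    by rewrite -!(shM hphi); congr (phi _); apply: C_eq => z; exact: mulrC.
  by rewrite -!(shM hphi) -(shD hphi) HK (sh1 hphi).
apply: cnorm_le_sq => //; rewrite -(shS hphi) -(shM hphi).
have -> : star f * f = cscale (M ^+ 2)%:C H.
  apply: C_eq => z; change ((f z)^* * f z = (M ^+ 2)%:C * (h z)%:C).
  rewrite -normc_sqE -rmorphM /h expr_div_n; congr (_%:C).
  by rewrite mulrC divfK// sqrf_eq0.
rewrite (shZ hphi) cnormS normc_real ger0_norm ?sqr_ge0//.
by rewrite -[leRHS]mulr1 ler_wpM2l ?sqr_ge0.
Qed.

End StarHom.

(** * Continuity of the functional calculus *)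

Section CalculusContinuity.
Variables (R : realType) (A : cstarAlgType R).
Local Notation T := (@circle R).
Local Notation CT := (C_circle R).
Local Notation z0 := (idC R).
Implicit Types (phi psi : CT -> A) (f g : CT).

(** The modulus [d] is uniform in [phi] and [psi], because it will be applied to evaluations at
    eigenvalues that are still unknown when [d] is chosen. *)
Definition calc_cont f := forall e : R, 0 < e -> exists2 d : R, 0 < d &
  forall phi psi, is_starhom phi -> is_starhom psi ->
    cnorm (phi z0 - psi z0) < d -> cnorm (phi f - psi f) < e.

Lemma starhom_bound f : exists2 M : R, 0 < M & forall phi, is_starhom phi -> cnorm (phi f) <= M.
Proof.
exists (C_norm f + 1); first by rewrite ltr_wpDl// C_norm_ge0.
move=> phi h; apply: starhom_contractive => // z.
by rewrite (le_trans (C_norm_ub f z))// lerDl.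
Qed.

Lemma calc_cont_id : calc_cont z0.
Proof. by move=> e e0; exists e. Qed.

Lemma calc_cont1 : calc_cont 1.
Proof.
move=> e e0; exists 1 => // phi psi h k _.
by rewrite (sh1 h) (sh1 k) subrr cnorm0.
Qed.

Lemma calc_cont0 : calc_cont 0.
Proof.
move=> e e0; exists 1 => // phi psi h k _.
by rewrite (starhom0 h) (starhom0 k) subrr cnorm0.
Qed.

Lemma calc_contD f g : calc_cont f -> calc_cont g -> calc_cont (f + g).
Proof.
move=> hf hg e e0; have e2 : 0 < e / 2 by rewrite divr_gt0.
have [[d1 d10 h1] [d2 d20 h2]] := (hf _ e2, hg _ e2).
exists (Num.min d1 d2); first by rewrite lt_min d10.
move=> phi psi h k; rewrite lt_min => /andP[/(h1 _ _ h k) l1 /(h2 _ _ h k) l2].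
rewrite (shD h) (shD k) opprD addrACA (splitr e).
exact: le_lt_trans (cnormD _ _) (ltrD l1 l2).
Qed.

Lemma calc_contZ a f : calc_cont f -> calc_cont (cscale a f).
Proof.
move=> hf e e0; have a0 : 0 < normc a + 1 by rewrite ltr_wpDl// normc_ge0.
have [d d0 hd] := hf _ (divr_gt0 e0 a0); exists d => // phi psi h k /(hd _ _ h k).
rewrite ltr_pdivlMr// (shZ h) (shZ k) -scalerBr cnormS => l; apply: le_lt_trans _ l.
by rewrite [leLHS]mulrC ler_wpM2l ?cnorm_ge0// lerDl.
Qed.

Lemma calc_cont_star f : calc_cont f -> calc_cont (star f).
Proof.
move=> hf e /hf[d d0 hd]; exists d => // phi psi h k /(hd _ _ h k).
by rewrite (shS h) (shS k) -starB cnorm_star.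
Qed.

Lemma calc_contM f g : calc_cont f -> calc_cont g -> calc_cont (f * g).
Proof.
move=> hf hg e e0; have e2 : 0 < e / 2 by rewrite divr_gt0.
have [[M M0 hM] [N N0 hN]] := (starhom_bound f, starhom_bound g).
have [d1 d10 h1] := hf _ (divr_gt0 e2 N0).
have [d2 d20 h2] := hg _ (divr_gt0 e2 M0).
exists (Num.min d1 d2); first by rewrite lt_min d10.
move=> phi psi h k; rewrite lt_min => /andP[/(h1 _ _ h k) + /(h2 _ _ h k)].
rewrite (ltr_pdivlMr _ _ N0) (ltr_pdivlMr _ _ M0) => l1 l2; rewrite (shM h) (shM k).
have -> : phi f * phi g - psi f * psi g =
    (phi f - psi f) * phi g + psi f * (phi g - psi g).
  by rewrite mulrBl mulrBr addrA subrK.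
apply: le_lt_trans (cnormD _ _) _; rewrite (splitr e) ltrD//.
  apply: le_lt_trans (cnormM _ _) _. apply: le_lt_trans _ l1.
  by rewrite ler_wpM2l ?cnorm_ge0 ?hN.
apply: le_lt_trans (cnormM _ _) _; apply: le_lt_trans _ l2.
by rewrite mulrC ler_wpM2l ?cnorm_ge0 ?hM.
Qed.

Lemma calc_contX f n : calc_cont f -> calc_cont (f ^+ n).
Proof.
move=> hf; elim: n => [|n IH]; first by rewrite expr0; exact: calc_cont1.
by rewrite exprS; exact: calc_contM.
Qed.

Lemma calc_cont_sum (I : eqType) (r : seq I) (F : I -> CT) :
  (forall i, calc_cont (F i)) -> calc_cont (\sum_(i <- r) F i).
Proof. by move=> h; elim/big_ind: _ => //; [exact: calc_cont0|exact: calc_contD]. Qed.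

(** Resolvent identity: phi(g) - psi(g) = phi(g) (psi(f) - phi(f)) psi(g), with both outer factors
    bounded uniformly. *)
Lemma calc_contV f g : g * f = 1 -> f * g = 1 -> calc_cont f -> calc_cont g.
Proof.
move=> gf fg hf e e0; have [N N0 hN] := starhom_bound g.
have [d d0 hd] := hf _ (divr_gt0 (divr_gt0 e0 N0) N0); exists d => // phi psi h k /(hd _ _ h k).
rewrite !(ltr_pdivlMr _ _ N0) => l.
have -> : phi g - psi g = phi g * (psi f - phi f) * psi g.
  rewrite mulrBr mulrBl -!mulrA -(shM k) fg (sh1 k) mulr1.
  by rewrite mulrA -(shM h) gf (sh1 h) mul1r.
apply: le_lt_trans (cnormM _ _) _; apply: le_lt_trans _ l.
rewrite ler_pM ?cnorm_ge0 ?hN//.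
apply: le_trans (cnormM _ _) _.
by rewrite mulrC cnormBC ler_wpM2l ?cnorm_ge0 ?hN.
Qed.

Lemma calc_cont_lim f :
  (forall e : R, 0 < e -> exists2 g, calc_cont g & forall z, normc (f z - g z) <= e) ->
  calc_cont f.
Proof.
move=> H e e0; have e3 : 0 < e / 3 by rewrite divr_gt0.
have [g hg fg] := H _ e3; have [d d0 hd] := hg _ e3.
exists d => // phi psi h k /(hd _ _ h k) l.
have l1 : cnorm (phi f - phi g) <= e / 3.
  by rewrite -(starhomB h); apply: starhom_contractive.
have l2 : cnorm (psi f - psi g) <= e / 3.
  by rewrite -(starhomB k); apply: starhom_contractive.
have t1 := cnorm_tri (phi f) (phi g) (psi f).
have t2 := cnorm_tri (phi g) (psi g) (psi f).
rewrite (cnormBC (psi g)) in t2.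
move: (cnorm _) (cnorm _) (cnorm _) (cnorm _) (cnorm _) l l1 l2 t1 t2 => a b c m n; lra.
Qed.

(** On the circle the squared chord length is a trigonometric polynomial in [x], so the weights used
    below are built from [z0] and its adjoint. *)
Lemma circle_distE (x y : T) :
  (4 - normc (val x - val y) ^+ 2)%:C = 2 + (val y)^* * val x + val y * (val x)^*.
Proof.
have := circle_normc x; have := circle_normc y.
move=> /(congr1 (fun r => r ^+ 2)) + /(congr1 (fun r => r ^+ 2)).
rewrite expr1n !sqr_normc; move: (val x) (val y) => [a b] [c d] /= hx hy.
apply/eqP; rewrite eq_complex /= !(mul0r, mulr0, oppr0, addr0); apply/andP; split; apply/eqP.
  lra.
ring.
Qed.


(* f is approximated by the means of its values on a net, weighted by the powers
   (4 - |x - y|^2)^n, which concentrate near x = y. *)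
Lemma calc_cont_all f : calc_cont f.
Proof.
apply: calc_cont_lim => e e0.
have e2 : 0 < e / 2 by rewrite divr_gt0.
have [d0 d00 hd0] := C_circle_unif f e2.
(* The cap 1 keeps [q = 4 - d ^+ 2] nonnegative. *)
pose d := Num.min d0 1; have dp : 0 < d by rewrite lt_min d00 ltr01.
have d1 : d <= 1 by rewrite ge_min lexx orbT.
have hd x y : normc (val x - val y) < d -> normc (f x - f y) < e / 2.
  by move=> h; apply: hd0; apply: lt_le_trans h _; rewrite ge_min lexx.
have [s hs] := circle_net (divr_gt0 dp (ltr0n _ 2)).
pose w (y x : T) := 4 - normc (val x - val y) ^+ 2.
have w0 y x : 0 <= w y x.
  have : normc (val x - val y) <= 2.
    by apply: le_trans (normc_triangle _ _) _; rewrite normcN !circle_normc.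
  rewrite /w subr_ge0 => h; have -> : (4 : R) = 2 ^+ 2 by ring.
  by rewrite ler_pXn2r ?nnegrE ?normc_ge0.
pose W (y : T) : CT := cscale 2 1 + cscale (val y)^* z0 + cscale (val y) (star z0).
have WE y x : W y x = (w y x)%:C.
  by rewrite /w circle_distE; change (2 * 1 + (val y)^* * val x + val y * (val x)^* =
    2 + (val y)^* * val x + val y * (val x)^*); rewrite mulr1.
have hW y : calc_cont (W y).
  by do !apply: calc_contD; apply: calc_contZ; rewrite ?calc_cont_star//;
    [exact: calc_cont1|exact: calc_cont_id|exact/calc_cont_star/calc_cont_id].
(* Some net point lies within [d / 2] of [x] and has weight at least [p]; those at distance [d] or
   more have weight at most [q < p], so their share vanishes as the exponent grows. *)
pose p : R := 4 - (d / 2) ^+ 2; pose q : R := 4 - d ^+ 2.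
have q0 : 0 <= q by rewrite /q; nra.
have qp : q < p by rewrite /q /p; nra.
have p0 : 0 < p := le_lt_trans q0 qp.
have [M M0 fM] : exists2 M : R, 0 < M & forall z, normc (f z) <= M.
  exists (C_norm f + 1); first by rewrite ltr_wpDl// C_norm_ge0.
  by move=> z; rewrite (le_trans (C_norm_ub f z))// lerDl.
have [n hn] : exists n, (size s)%:R * (2 * M) * q ^+ n <= (e / 2) * p ^+ n.
  have qp1 : `|q / p| < 1 by rewrite ger0_norm ?divr_ge0 ?(ltW p0)// ltr_pdivrMr// mul1r.
  pose c : R := e / 2 / ((size s)%:R * (2 * M) + 1).
  have den : 0 < (size s)%:R * (2 * M) + 1 by rewrite ltr_wpDl// mulr_ge0 ?mulr_ge0// ltW.
  have c0 : 0 < c by rewrite divr_gt0.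
  have /cvgrPdist_lt /(_ c c0) [n _ /(_ n (leqnn n))] := cvg_expr qp1.
  rewrite /= sub0r normrN ger0_norm ?exprn_ge0 ?divr_ge0 ?(ltW p0)//.
  rewrite expr_div_n (ltr_pdivrMr _ _ (exprn_gt0 n p0)) /c mulrAC (ltr_pdivlMr _ _ den) => /ltW h.
  exists n; apply: le_trans h; rewrite mulrC ler_wpM2l ?exprn_ge0//.
  by rewrite lerDl.
pose S x := \sum_(y <- s) w y x ^+ n.
have pS x : p ^+ n <= S x.
  have [y ys xy] := hs x.
  rewrite /S (perm_big _ (perm_to_rem ys)) big_cons /= (@le_trans _ _ (w y x ^+ n))//.
    rewrite lerXn2r ?nnegrE ?(ltW p0) ?w0//.
    by rewrite /p /w lerD2l lerN2 ler_pXn2r ?nnegrE ?normc_ge0 ?(ltW xy)// divr_ge0// ltW.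
  by rewrite lerDl sumr_ge0// => i _; rewrite exprn_ge0.
have S0 x : 0 < S x := lt_le_trans (exprn_gt0 n p0) (pS x).
pose D : CT := \sum_(y <- s) W y ^+ n.
have DE x : D x = (S x)%:C.
  by rewrite C_sumE rmorph_sum; apply: eq_bigr => y _; rewrite C_expE WE rmorphXn.
have cS : continuous (fun x => (normc (D x))^-1).
  move=> x; apply: (@cvgV _ _ _ (nbhs_filter x)); last exact: normc_comp_continuous.
  by rewrite DE normc_real gtr0_norm// gt_eqF.
pose G : CT := realC cS.
have GE x : G x = (S x)^-1%:C.
  by change ((normc (D x))^-1%:C = (S x)^-1%:C); rewrite DE normc_real gtr0_norm.
have GD : G * D = 1.
  apply: C_eq => x; change (G x * D x = 1).
  by rewrite GE DE -rmorphM mulVf ?gt_eqF ?rmorph1.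
have hG : calc_cont G.
  apply: (@calc_contV D) => //.
    by rewrite -GD; apply: C_eq => x; exact: mulrC.
  by apply: calc_cont_sum => y; exact: calc_contX.
exists (G * \sum_(y <- s) cscale (f y) (W y ^+ n)).
  by apply: calc_contM => //; apply: calc_cont_sum => y; apply: calc_contZ; exact: calc_contX.
move=> x; set H := \sum_(_ <- s) _; change (normc (f x - G x * H x) <= e).
have -> : f x - G x * H x = G x * \sum_(y <- s) (f x - f y) * ((w y x) ^+ n)%:C.
  have fE : f x = G x * (f x * D x).
    by rewrite mulrCA [G x * D x](congr1 (fun g => C_fun g x) GD) mulr1.
  rewrite {1}fE -mulrBr /H /D !C_sumE; congr (_ * _); rewrite mulr_sumr -sumrB; apply: eq_bigr => y _.
  change (f x * (W y ^+ n) x - f y * (W y ^+ n) x = (f x - f y) * ((w y x) ^+ n)%:C).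
  by rewrite C_expE WE rmorphXn mulrBl.
rewrite normcM GE normc_real ger0_norm ?invr_ge0 ?(ltW (S0 x))// mulrC (ler_pdivrMr _ _ (S0 x)).
have term y : normc ((f x - f y) * ((w y x) ^+ n)%:C) <= e / 2 * w y x ^+ n + 2 * M * q ^+ n.
  rewrite normcM normc_real ger0_norm ?exprn_ge0//.
  have [xy|xy] := ltP (normc (val x - val y)) d.
    apply: (@le_trans _ _ (e / 2 * w y x ^+ n)).
      by rewrite ler_wpM2r ?exprn_ge0// ltW// hd.
    by rewrite lerDl !mulr_ge0 ?exprn_ge0// ltW.
  apply: (@le_trans _ _ (2 * M * q ^+ n)); last first.
    by rewrite lerDr mulr_ge0 ?exprn_ge0// ltW.
  apply: ler_pM; rewrite ?normc_ge0 ?exprn_ge0//.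
    apply: le_trans (normc_triangle _ _) _; rewrite normcN.
    by rewrite mulr_natl mulr2n lerD.
  rewrite lerXn2r ?nnegrE// /w /q lerD2l lerN2 ler_pXn2r ?nnegrE ?normc_ge0//.
  exact: ltW.
apply: le_trans (_ : \sum_(y <- s) (e / 2 * w y x ^+ n + 2 * M * q ^+ n) <= _).
  elim/big_rec2: _ => [|y a b _ ab]; first by rewrite normc0.
  by apply: le_trans (normc_triangle _ _) _; rewrite lerD.
rewrite big_split /= -mulr_sumr big_const_seq count_predT iter_addr_0 -[X in _ + X]mulr_natl [X in _ + X]mulrA.
rewrite -/(S x) [in leRHS](splitr e) (mulrDl _ _ (S x)) lerD2l.
apply: le_trans hn _.
by rewrite ler_wpM2l// ltW.
Qed.

End CalculusContinuity.

(** * Cuntz comparison in the corner of the stabilization *)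

Section CornerEmbedding.
Variables (R : realType) (A : cstarAlgType R).
Implicit Types (a b r : infmx A) (x y : A).

(** The elementary tensor of [x] with the rank-one matrix unit at (0,0). *)
Definition corner_emb x : infmx A := fun i j => if (i == 0%N) && (j == 0%N) then x else 0.

(** Entries of a product are limits of partial sums; here these are constant from [n = 1] on. *)
Lemma stab_mul_col0 a b i j :
  (forall k, (0 < k)%N -> a i k * b k j = 0) -> stab_mul a b i j = a i 0%N * b 0%N j.
Proof.
move=> h; apply: lim_near_cst; first exact: norm_hausdorff.
exists 1%N => // n /= n1; case: n n1 => // n _.
rewrite big_ord_recl /= big1 ?addr0// => k _; exact: h.
Qed.

Lemma col_norm0 n : col_norm (0 : 'cV[A]_n) = 0.
Proof.
rewrite /col_norm big1 ?cnorm0 ?sqrtr0// => i _.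
by rewrite mxE mulr0.
Qed.

Lemma stab_norm0 : stab_norm (0 : infmx A) = 0%E.
Proof.
have m0 n : mx_norm (\matrix_(i < n, j < n) (0 : infmx A) i j) = 0%E.
  rewrite /mx_norm; have -> : \matrix_(i < n, j < n) (0 : infmx A) i j = 0.
    by apply/matrixP => i j; rewrite !mxE.
  rewrite (_ : [set _ | _ in _] = [set 0%E]) ?ereal_sup1//.
  apply/seteqP; split=> [_ [x _ <-]|_ ->] /=; first by rewrite mul0mx col_norm0.
  by exists 0; rewrite /= ?mul0mx col_norm0// ler01.
rewrite /stab_norm.
have -> : range (fun n => mx_norm (\matrix_(i < n, j < n) (0 : infmx A) i j)) = [set 0%E];
  last by rewrite ereal_sup1.
apply/seteqP; split=> [_ [n _ <-]|_ ->] /=; first by rewrite m0.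
by exists 0%N; rewrite ?m0.
Qed.

Lemma stab_corner_emb x : stab (corner_emb x).
Proof.
rewrite /stab /=; apply: cvg_near_cst; exists 1%N => // n /= n1.
rewrite (_ : corner_emb x - corner n (corner_emb x) = 0) ?stab_norm0//.
apply/funext => i; apply/funext => j; rewrite /corner /corner_emb.
change ((if (i == 0%N) && (j == 0%N) then x else 0) -
  (if (i < n)%N && (j < n)%N then if (i == 0%N) && (j == 0%N) then x else 0 else 0) = 0).
by case: i j => [|i] [|j] /=; rewrite ?n1 ?if_same subrr.
Qed.

Lemma stab_star_emb x : stab_star (corner_emb x) = corner_emb (star x).
Proof.
apply/funext => i; apply/funext => j; rewrite /stab_star /corner_emb andbC.
by case: ifP => //; rewrite star0.
Qed.

Lemma stab_mul_emb x y : stab_mul (corner_emb x) (corner_emb y) = corner_emb (x * y).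
Proof.
apply/funext => i; apply/funext => j; rewrite stab_mul_col0.
  by rewrite /corner_emb !eqxx /= andbT; case: eqP => _; case: eqP => _; rewrite /= ?mul0r ?mulr0.
by move=> [|k]// _; rewrite /corner_emb /= andbF mul0r.
Qed.

Lemma stab_pos_emb x : stab_pos (corner_emb (star x * x)).
Proof.
by exists (corner_emb x); [exact: stab_corner_emb|rewrite stab_star_emb stab_mul_emb].
Qed.

(** The 1 x 1 block, tested on the column with entry 1, already attains this value. *)
Lemma cnorm_entry00 a : ((cnorm (a 0%N 0%N))%:E <= stab_norm a)%E.
Proof.
apply: le_trans (_ : (mx_norm (\matrix_(i < 1, j < 1) a i j) <= _)%E); last first.
  by apply: ereal_sup_ubound; exists 1%N.
apply: ereal_sup_ubound; exists 1%:M => /=.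
  rewrite /col_norm big_ord1 !mxE /= star1 mulr1.
  by rewrite -[leRHS]sqrtr1 ler_sqrt ?ler01// cnorm1_le.
rewrite mulmx1 /col_norm big_ord1 !mxE cnorm_starM sqrtr_sqr.
by rewrite ger0_norm ?cnorm_ge0.
Qed.

(** Since [corner_emb y] kills every other column of [r n], the (0,0) entry of the product involves
    only the (0,0) entry of [r n], and passing to an entry does not increase the error. *)
Lemma cuntz_le_corner_emb x y (e : R) : 0 < e -> cuntz_le (corner_emb x) (corner_emb y) ->
  exists r : A, cnorm (r * y * star r - x) < e.
Proof.
move=> e0 [r [_ hr]].
have : \forall n \near \oo, (stab_norm (stab_mul (stab_mul (r n) (corner_emb y)) (stab_star (r n)) - corner_emb x)%R
   < e%:E)%E.
  have : nbhs (0%E : \bar R) [set t | (t < e%:E)%E].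
    by apply: open_nbhs_nbhs; split; [exact: open_ereal_lt_ereal|rewrite /= lte_fin].
  exact: hr.
move=> [n _ /(_ n (leqnn n)) /= h].
exists (r n 0%N 0%N); have := le_lt_trans (cnorm_entry00 _) h.
rewrite lte_fin; set m := (_ - _ : infmx A).
have -> : m 0%N 0%N = stab_mul (stab_mul (r n) (corner_emb y)) (stab_star (r n)) 0%N 0%N - x by [].
have c k : stab_mul (r n) (corner_emb y) 0%N k = if k == 0%N then r n 0%N 0%N * y else 0.
  rewrite stab_mul_col0 /corner_emb /=; first by case: eqP; rewrite ?mulr0.
  by move=> [|j]// _; rewrite mulr0.
rewrite stab_mul_col0 ?c// => k k0; rewrite c; case: k k0 => // k _.
by rewrite mul0r.
Qed.

Lemma cuntz_le_emb_refl x : cuntz_le (corner_emb x) (corner_emb x).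
Proof.
exists (fun=> corner_emb 1); split; first by move=> _; exact: stab_corner_emb.
apply: cvg_near_cst; apply: nearW => n.
by rewrite stab_star_emb !stab_mul_emb star1 mul1r mulr1 subrr stab_norm0.
Qed.

End CornerEmbedding.

(** Classes are sets of matrices: by reflexivity the image under [phi] lies in its own class, hence
    in that of the image under [psi], and this membership contains the comparison. *)
Lemma Cu_map_cuntz (R : realType) (B A : cstarAlgType R) (phi psi : unital_starhom B A) (g : B)
    (e : R) : Cu_map phi (corner_emb (star g * g)) = Cu_map psi (corner_emb (star g * g)) -> 0 < e ->
  exists r : A, cnorm (r * psi (star g * g) * star r - phi (star g * g)) < e.
Proof.
move=> h e0.
have mapE (chi : unital_starhom B A) x : stab_map chi (corner_emb x) = corner_emb (chi x).
  by apply/funext => i; apply/funext => j; rewrite /stab_map /corner_emb; case: ifP; rewrite ?rmorph0.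
have : Cu_map phi (corner_emb (star g * g)) (corner_emb (phi (star g * g))).
  split; rewrite ?mapE ?rmorphM ?starhom_star; first exact: stab_pos_emb.
  by split; exact: cuntz_le_emb_refl.
rewrite h => -[_ []]; rewrite mapE => _; exact: cuntz_le_corner_emb.
Qed.

(** * Finite-dimensional subalgebras *)

Lemma left_kernel (F : fieldType) (m n : nat) (C : 'M[F]_(m, n)) : (n < m)%N ->
  exists2 c : 'rV_m, c != 0 & c *m C = 0.
Proof.
move=> nm; have : kermx C != 0.
  by rewrite -mxrank_eq0 mxrank_ker subn_eq0 -ltnNge (leq_ltn_trans (rank_leq_col C)).
by move=> /rowV0Pn[c /sub_kermxP cC c0]; exists c.
Qed.

Section PolynomialCalculus.
Variables (R : realType) (A : cstarAlgType R).
Implicit Types (x y z : A) (P Q : {poly R[i]}).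

Definition ev y P : A := \sum_(i < size P) P`_i *: y ^+ i.

Lemma ev_widen y P n : (size P <= n)%N -> ev y P = \sum_(i < n) P`_i *: y ^+ i.
Proof.
move=> h; rewrite /ev (big_ord_widen n (fun i => P`_i *: y ^+ i) h) big_mkcond /=.
apply: eq_bigr => i _; case: ltnP => // Pi.
by rewrite nth_default ?scale0r.
Qed.

Lemma evD y P Q : ev y (P + Q) = ev y P + ev y Q.
Proof.
have n1 := leq_maxl (size P) (size Q); have n2 := leq_maxr (size P) (size Q).
rewrite (ev_widen y n1) (ev_widen y n2) (ev_widen y (size_polyD P Q)) -big_split.
by apply: eq_bigr => i _; rewrite coefD scalerDl.
Qed.

Lemma evC y c : ev y c%:P = c *: (1 : A).
Proof.
by rewrite (@ev_widen y _ 1) ?size_polyC_leq1// big_ord1 coefC.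
Qed.

Lemma ev0 y : ev y 0 = 0. Proof. by rewrite -[0 in LHS]/(0%:P) evC scale0r. Qed.

Lemma ev1 y : ev y 1 = 1. Proof. by rewrite -[1 in LHS]/(1%:P) evC scale1r. Qed.

Lemma evMX y P : ev y (P * 'X) = ev y P * y.
Proof.
rewrite (@ev_widen y _ (size P).+1); last first.
  by have [->|P0] := eqVneq P 0; rewrite ?mul0r ?size_poly0// size_mulX.
rewrite big_ord_recl coefMX scale0r add0r /ev mulr_suml; apply: eq_bigr => i _.
by rewrite coefMX /= exprSr -cscalerAl.
Qed.

Lemma evZ y c P : ev y (c *: P) = c *: ev y P.
Proof.
rewrite (ev_widen y (size_scale_leq c P)) /ev scaler_sumr; apply: eq_bigr => i _.
by rewrite coefZ scalerA.
Qed.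

Lemma evM y P Q : ev y (P * Q) = ev y P * ev y Q.
Proof.
elim/poly_ind: Q => [|Q c IH]; first by rewrite mulr0 ev0 mulr0.
rewrite mulrDr mulrA evD evMX IH [P * _]mulrC mul_polyC evZ evD evMX evC.
by rewrite mulrDr mulrA -cscalerAr mulr1.
Qed.

Lemma evX y : ev y 'X = y.
Proof. by rewrite -['X]mul1r evMX ev1 mul1r. Qed.

Lemma ev_exp y P n : ev y (P ^+ n) = ev y P ^+ n.
Proof. by elim: n => [|n IH]; rewrite ?ev1// !exprS evM IH. Qed.

Lemma ev_sum y (I : Type) (r : seq I) (p : pred I) (F : I -> {poly R[i]}) :
  ev y (\sum_(i <- r | p i) F i) = \sum_(i <- r | p i) ev y (F i).
Proof. by elim/big_rec2: _ => [|i x z _ <-]; rewrite ?ev0 ?evD. Qed.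

Lemma ev_comm x y P : x * y = y * x -> x * ev y P = ev y P * x.
Proof.
move=> xy; rewrite /ev mulr_sumr mulr_suml; apply: eq_bigr => i _.
rewrite -cscalerAr -cscalerAl; congr (_ *: _).
exact: commrX.
Qed.

Lemma ev_normal y P : star y * y = y * star y ->
  star (ev y P) * ev y P = ev y P * star (ev y P).
Proof.
move=> /(ev_comm P) h; apply: ev_comm.
by move/(congr1 (@star _ _)): h; rewrite !starM starK.
Qed.

Lemma star_mul_eq0 x : star x * x = 0 -> x = 0.
Proof.
move=> /(congr1 (@cnorm _ _)); rewrite cnorm_starM cnorm0 => /eqP.
by rewrite expf_eq0 /= => /eqP /cnorm_eq0.
Qed.

(** If x is normal and x^2 = 0, then the square of [star x * x] is [star x * star x * x * x = 0],
    and the C*-identity used twice gives x = 0. Raising the exponent to a power of two lets this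
    step halve it. *)
Lemma normal_nilpotent z n : star z * z = z * star z -> z ^+ n = 0 -> z = 0.
Proof.
have sq x : star x * x = x * star x -> x ^+ 2 = 0 -> x = 0.
  move=> xx x2; apply: star_mul_eq0; apply: star_mul_eq0.
  by rewrite starM starK -!mulrA (mulrA x) -xx -!mulrA -expr2 x2 !mulr0.
move=> zz zn; have : z ^+ (2 ^ n) = 0.
  by rewrite -(subnK (ltnW (ltn_expl n (ltnSn 1)))) exprD zn mulr0.
move=> {zn}; elim: n z zz => [|k IH] z zz; first by rewrite expr1.
rewrite expnS exprM => /IH h; apply: sq => //; apply: h.
by rewrite starX; apply/commrX/commr_sym/commrX/commr_sym.
Qed.

End PolynomialCalculus.

Section FiniteDimensional.
Variables (R : realType) (A : cstarAlgType R) (B : set A).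
Hypotheses (hB : star_subalgebra B) (fB : fin_dim B).
Implicit Types (x y z : A) (P Q : {poly R[i]}).

Lemma subalg0 : B 0. Proof. by case: hB. Qed.
Lemma subalgD x y : B x -> B y -> B (x + y). Proof. by case: hB => _ h _ _ _; exact: h. Qed.
Lemma subalgZ c x : B x -> B (c *: x). Proof. by case: hB => _ _ h _ _; exact: h. Qed.
Lemma subalgM x y : B x -> B y -> B (x * y). Proof. by case: hB => _ _ _ h _; exact: h. Qed.
Lemma subalgS x : B x -> B (star x). Proof. by case: hB => _ _ _ _; exact. Qed.
Lemma subalgN x : B x -> B (- x). Proof. by rewrite -scaleN1r; exact: subalgZ. Qed.
Lemma subalgB x y : B x -> B y -> B (x - y). Proof. by move=> ? ?; apply: subalgD => //; exact: subalgN. Qed.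
Lemma subalg_sum (I : Type) (r : seq I) (p : pred I) (F : I -> A) :
  (forall i, p i -> B (F i)) -> B (\sum_(i <- r | p i) F i).
Proof. by move=> h; elim/big_ind: _ => //; [exact: subalg0|exact: subalgD]. Qed.

Lemma subalgXS x n : B x -> B (x ^+ n.+1).
Proof. by move=> Bx; elim: n => [//|n IH]; rewrite exprS; exact: subalgM. Qed.

Lemma fin_dim_dependent : exists d, forall x : 'I_d.+1 -> A, (forall i, B (x i)) ->
  exists2 c : 'rV[R[i]]_d.+1, c != 0 & \sum_i c 0 i *: x i = 0.
Proof.
have [s Bs] := fB; exists (size s) => x Bx.
have /choice[C hC] : forall i, exists c : 'I_(size s) -> R[i], x i = \sum_(j < size s) c j *: s`_j.
  by move=> i; have := Bx i; rewrite {1}Bs.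
have [c c0 cC] := left_kernel (\matrix_(i, j) C i j) (ltnSn (size s)); exists c => //.
under eq_bigr do rewrite hC scaler_sumr.
rewrite exchange_big big1//= => j _.
under eq_bigr do rewrite scalerA.
rewrite -scaler_suml; have /rowP/(_ j) := cC; rewrite !mxE.
by under eq_bigr do rewrite mxE; move=> ->; rewrite scale0r.
Qed.

(* x is left cancellable, so dividing a linear relation between its powers by the lowest one
   expresses 1 by positive powers of x. *)
Lemma fin_dim_unit x : B x -> cnorm (1 - x) < 1 -> B 1.
Proof.
move=> Bx x1; have canc y : x * y = 0 -> y = 0.
  move=> xy; apply: cnorm_eq0; apply/eqP; rewrite eq_le cnorm_ge0 andbT.
  have := cnormM (1 - x) y; rewrite mulrBl mul1r xy subr0.
  have := cnorm_ge0 y; move: (cnorm y) (cnorm _) x1 => a b; nra.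
suff H n (c : nat -> R[i]) : (exists2 i, (i < n)%N & c i != 0) ->
    \sum_(i < n) c i *: x ^+ i.+1 = 0 -> B 1.
  have [d hd] := fin_dim_dependent.
  have [c c0 hc] := hd (fun i => x ^+ i.+1) (fun i => subalgXS i Bx).
  apply: (H d.+1 (fun i => c 0 (inord i))); last first.
    by rewrite -[RHS]hc; apply: eq_bigr => i _; rewrite inord_val.
  have /rV0Pn[i ci] := c0; exists i => //.
  by rewrite inord_val.
elim: n c => [|n IH] c; first by case.
rewrite big_ord_recl => -[i i_n ci] hs.
have {}hs : c 0%N *: (1 : A) + \sum_(i < n) c i.+1 *: x ^+ i.+1 = 0.
  apply: canc; rewrite -[RHS]hs mulrDr mulr_sumr -cscalerAr mulr1 expr1.
  by congr (_ + _); apply: eq_bigr => j _; rewrite -cscalerAr -exprS.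
have [c0|c0] := eqVneq (c 0%N) 0; last first.
  have -> : (1 : A) = - (c 0%N)^-1 *: \sum_(i < n) c i.+1 *: x ^+ i.+1.
    move: hs => /(congr1 (fun y => (c 0%N)^-1 *: y)).
    rewrite scalerDr scaler0 scalerA mulVf// scale1r => /eqP.
    by rewrite addr_eq0 => /eqP ->; rewrite scaleNr.
  by apply: subalgZ; apply: subalg_sum => j _; apply: subalgZ; exact: subalgXS.
apply: (IH (fun i => c i.+1)); last by rewrite -[RHS]hs c0 scale0r add0r.
by case: i i_n ci => [|i]; [rewrite c0 eqxx|exists i].
Qed.

Hypothesis B1 : B 1.

Lemma subalgX x n : B x -> B (x ^+ n).
Proof. by case: n => [//|n]; exact: subalgXS. Qed.

Lemma subalg_ev y P : B y -> B (ev y P).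
Proof. by move=> By; apply: subalg_sum => i _; apply: subalgZ; exact: subalgX. Qed.

Lemma annihilating_poly y : B y -> exists2 P, P != 0 & ev y P = 0.
Proof.
move=> By; have [d hd] := fin_dim_dependent.
have [c c0 hc] := hd (fun i => y ^+ i) (fun i => subalgX i By).
exists (\poly_(i < d.+1) c 0 (inord i)).
  apply/eqP => P0; move: c0 => /rV0Pn[i /eqP]; apply.
  by have := congr1 (fun p : {poly R[i]} => p`_i) P0; rewrite coef_poly coef0 ltn_ord inord_val.
rewrite (@ev_widen _ _ _ _ d.+1) ?size_poly// -[RHS]hc; apply: eq_bigr => i _.
by rewrite coef_poly ltn_ord inord_val.
Qed.

End FiniteDimensional.

(** * Spectral theorem in a finite-dimensional subalgebra *)

Section Spectral.
Variables (R : realType) (A : cstarAlgType R).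
Implicit Types (x y z : A) (P Q : {poly R[i]}).

(** A finite projection-valued measure. Zero projections are allowed; where projections are counted,
    nonvanishing is assumed separately. *)
Definition pvm (B : set A) N (e : 'I_N -> A) : Prop :=
  [/\ forall i, B (e i), forall i, star (e i) = e i,
      forall i j, e i * e j = if i == j then e i else 0 & \sum_i e i = 1].

(** By normality [1 - x] passes through [1 - star x] and kills [x], so the C*-identity gives (1 -
    star x) x = 0. Thus [x] equals the self-adjoint [star x * x]. *)
Lemma normal_idempotent_sa x : star x * x = x * star x -> x * x = x -> star x = x.
Proof.
move=> nx xx; have x1 : x = star x * x; last by rewrite {1}x1 starM starK -x1.
apply/eqP; rewrite -subr_eq0; apply/eqP.
have -> : x - star x * x = (1 - star x) * x by rewrite mulrBl mul1r.
apply: star_mul_eq0; rewrite starM starB star1 starK.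
rewrite -!mulrA; have -> : (1 - x) * ((1 - star x) * x) = 0; last by rewrite mulr0.
rewrite [(1 - star x) * x]mulrBl mul1r nx mulrBr mulrBl mul1r xx subrr sub0r.
by rewrite mulrBl mul1r mulrA xx subrr oppr0.
Qed.

Section Lagrange.
Variables (y : A) (s : seq R[i]).
Hypotheses (us : uniq s) (ys : ev y (\prod_(m <- s) ('X - m%:P)) = 0).

Let V l : {poly R[i]} := \prod_(m <- rem l s) ('X - m%:P).

(** The Lagrange polynomial with value 1 at [l] and 0 at the other nodes of [s], evaluated at
    [y]. *)
Definition eigenproj l : A := ev y ((V l).[l]^-1 *: V l).

Let V_neq0 l : (V l).[l] != 0.
Proof. by rewrite -rootE root_prod_XsubC mem_rem_uniqF. Qed.

Let VW l : l \in s -> ('X - l%:P) * V l = \prod_(m <- s) ('X - m%:P).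
Proof. by move=> ls; rewrite [RHS](perm_big _ (perm_to_rem ls)) big_cons. Qed.

Lemma eigenproj_eigen l : l \in s -> y * eigenproj l = l *: eigenproj l.
Proof.
move=> ls; have : ev y (('X - l%:P) * ((V l).[l]^-1 *: V l)) = 0.
  by rewrite -scalerAr VW// evZ ys scaler0.
rewrite evM evD -polyCN evX evC mulrDl -cscalerAl mul1r scaleNr => /eqP.
by rewrite subr_eq0 => /eqP.
Qed.

Lemma eigenproj_orth l m : l \in s -> m \in s -> l != m -> eigenproj l * eigenproj m = 0.
Proof.
move=> ls ms lm; rewrite -evM -scalerAl -scalerAr !evZ.
have mr : m \in rem l s by rewrite mem_rem_uniq// !inE eq_sym lm.
suff -> : ev y (V l * V m) = 0 by rewrite !scaler0.
rewrite [V l](perm_big _ (perm_to_rem mr)) big_cons /=.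
by rewrite mulrAC VW// evM ys mul0r.
Qed.

Lemma eigenproj_sum : \sum_(l <- s) eigenproj l = 1.
Proof.
(* Without nodes the annihilating product is 1, so [1 = 0] in [A]. *)
case: (posnP (size s)) => [/size0nil s0|s0].
  by move: ys; rewrite s0 !big_nil ev1.
rewrite -ev_sum -[RHS](ev1 y); congr (ev y _).
apply/eqP; rewrite -subr_eq0; apply/eqP.
(* The difference has degree below the number of nodes and vanishes at each of them. *)
apply: (@roots_geq_poly_eq0 _ _ s) => //.
  apply/allP => m ms; rewrite rootE hornerD hornerN hornerC horner_sum.
  rewrite (perm_big _ (perm_to_rem ms)) big_cons /= hornerZ mulVf ?V_neq0//.
  rewrite big1_seq ?addr0 ?subrr// => l /andP[_]; rewrite mem_rem_uniq// !inE => /andP[lm ls].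
  rewrite hornerZ (_ : (V l).[m] = 0) ?mulr0//; apply/eqP; rewrite -rootE root_prod_XsubC.
  by rewrite mem_rem_uniq// !inE eq_sym lm.
apply: (leq_trans (size_polyD _ _)); rewrite geq_max size_polyN size_poly1 s0 andbT.
apply: (leq_trans (size_sum _ _ _)); apply/bigmax_leqP_seq => l ls _.
apply: (leq_trans (size_scale_leq _ _)); rewrite size_prod_XsubC size_rem//.
by rewrite prednK.
Qed.

Lemma eigenproj_idem l : l \in s -> eigenproj l * eigenproj l = eigenproj l.
Proof.
move=> ls; rewrite -[RHS]mulr1 -eigenproj_sum (perm_big _ (perm_to_rem ls)) big_cons /=.
rewrite mulrDr [X in _ = _ + X]mulr_sumr [X in _ = _ + X]big1_seq ?addr0// => m /andP[_].
rewrite mem_rem_uniq// !inE => /andP[ml ms].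
by apply: eigenproj_orth => //; rewrite eq_sym.
Qed.

End Lagrange.

Variable B : set A.
Hypotheses (hB : star_subalgebra B) (fB : fin_dim B) (B1 : B 1).

Lemma spectral_theorem y : B y -> star y * y = y * star y ->
  exists N (e : 'I_N -> A) (l : 'I_N -> R[i]), [/\ pvm B e, forall i, e i != 0,
    y = \sum_i l i *: e i & forall z i, z * y = y * z -> z * e i = e i * z].
Proof.
move=> By ny.
have [s us ys] : exists2 s, uniq s & ev y (\prod_(m <- s) ('X - m%:P)) = 0.
  have [P P0 Py] := annihilating_poly hB fB B1 By.
  have [r Pr] := closed_field_poly_normal P.
  exists (undup r); first exact: undup_uniq.
  apply: (@normal_nilpotent _ _ _ (size r)); first exact: ev_normal.
  rewrite -ev_exp; set W := \prod_(m <- undup r) _.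
  (* The squarefree [W] has the same roots as [P], so the split form of [P] divides a power of [W];
     hence [ev y W] is nilpotent, and zero because it is normal. *)
  have /dvdpP[Q ->] : \prod_(m <- r) ('X - m%:P) %| W ^+ size r.
    suff H r' : {subset r' <= undup r} -> \prod_(m <- r') ('X - m%:P) %| W ^+ size r'.
      by apply: H => m; rewrite mem_undup.
    elim: r' => [|m r' IH] h; first by rewrite big_nil expr0 dvdpp.
    rewrite big_cons exprS dvdp_mul//.
      by rewrite dvdp_XsubCl root_prod_XsubC h// mem_head.
    by apply: IH => k kr; apply: h; rewrite inE kr orbT.
  rewrite evM; have : ev y (\prod_(m <- r) ('X - m%:P)) = 0; last by move=> ->; rewrite mulr0.
  move: Py; rewrite Pr evZ => /(congr1 (fun x => (lead_coef P)^-1 *: x)).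
  by rewrite scalerA mulVf ?lead_coef_eq0// scale1r scaler0.
pose p := eigenproj y s.
(* Roots of [P] outside the spectrum of [y] give zero projections, which are dropped here. *)
pose t := [seq l <- s | p l != 0].
have ut : uniq t by rewrite filter_uniq.
have ts i : (i < size t)%N -> t`_i \in s.
  by move=> it; have := mem_nth 0 it; rewrite mem_filter => /andP[].
have psum (F : R[i] -> A) : (forall l, p l = 0 -> F l = 0) -> \sum_(i < size t) F t`_i = \sum_(l <- s) F l.
  move=> F0; rewrite -(big_mkord xpredT (fun i => F t`_i)) -(big_nth 0 xpredT F) big_filter.
  by rewrite big_mkcond; apply: eq_bigr => l _; case: eqP => //= /F0 ->.
exists (size t), (fun i => p t`_i), (fun i => t`_i); split.
- split.
  + by move=> i; exact: subalg_ev.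
  + move=> i; apply: normal_idempotent_sa; first exact: ev_normal.
    by apply: eigenproj_idem => //; exact: ts.
  + move=> i j; case: eqP => [->|/eqP ij]; first by apply: eigenproj_idem => //; exact: ts.
    by apply: eigenproj_orth; rewrite ?ts ?nth_uniq.
  + by rewrite (psum p)// eigenproj_sum.
- by move=> i; have := mem_nth 0 (ltn_ord i); rewrite mem_filter => /andP[].
- rewrite (psum (fun l => l *: p l)) => [|l ->]; last by rewrite scaler0.
  rewrite -[LHS]mulr1 -(eigenproj_sum us ys) mulr_sumr.
  by rewrite !big_seq; apply: eq_bigr => l ls; rewrite eigenproj_eigen.
- by move=> z i; exact: ev_comm.
Qed.

End Spectral.

(** * Diagonal elements over a projection-valued measure *)

Section Pvm.
Variables (R : realType) (A : cstarAlgType R) (B : set A) (N : nat) (e : 'I_N -> A).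
Hypothesis pe : pvm B e.
Implicit Types a b : 'I_N -> R[i].

Lemma pvm_mulr a i : (\sum_j a j *: e j) * e i = a i *: e i.
Proof.
have [_ _ ee _] := pe; rewrite mulr_suml (bigD1 i)//= -cscalerAl ee eqxx big1 ?addr0// => j ji.
by rewrite -cscalerAl ee (negbTE ji) scaler0.
Qed.

Lemma pvm_mul a b : (\sum_i a i *: e i) * (\sum_i b i *: e i) = \sum_i (a i * b i) *: e i.
Proof.
rewrite mulr_sumr; apply: eq_bigr => i _.
by rewrite -cscalerAr pvm_mulr scalerA mulrC.
Qed.

Lemma pvm_star a : star (\sum_i a i *: e i) = \sum_i (a i)^* *: e i.
Proof.
have [_ es _ _] := pe; rewrite star_sum; apply: eq_bigr => i _.
by rewrite starS es.
Qed.

Lemma pvm_norm a (M : R) : 0 <= M -> (forall i, normc (a i) <= M) ->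
  cnorm (\sum_i a i *: e i) <= M.
Proof.
move=> M0 aM; have [M00|Mn0] := eqVneq M 0.
  rewrite big1 ?cnorm0// => i _; rewrite (_ : a i = 0) ?scale0r//.
  by apply: eq0_normc; apply/eqP; rewrite eq_le normc_ge0 -{1}M00 aM.
have Mp : 0 < M by rewrite lt_def Mn0.
(* The cosine and sine argument of [starhom_contractive], with functions on the index set. *)
pose h i := (normc (a i) / M) ^+ 2.
have h01 i : h i ^+ 2 <= 1.
  rewrite /h !exprn_ile1 ?exprn_ge0 ?divr_ge0 ?normc_ge0//.
  by rewrite ler_pdivrMr// mul1r.
pose k i := Num.sqrt (1 - h i ^+ 2).
have sa (g : 'I_N -> R) : star (\sum_i (g i)%:C *: e i) = \sum_i (g i)%:C *: e i.
  by rewrite star_sum; apply: eq_bigr => i _; rewrite starSR; have [_ -> _ _] := pe.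
have nH : cnorm (\sum_i (h i)%:C *: e i) <= 1.
  apply: (@cnorm_cos_le1 _ _ _ (\sum_i (k i)%:C *: e i)); rewrite ?sa ?pvm_mul//.
    by apply: eq_bigr => i _; rewrite mulrC.
  have [_ _ _ <-] := pe; rewrite -big_split; apply: eq_bigr => i _ /=.
  rewrite -scalerDl -!rmorphM -rmorphD -!expr2 sqr_sqrtr ?subr_ge0//.
  by rewrite addrC subrK scale1r.
apply: cnorm_le_sq => //; rewrite pvm_star pvm_mul.
have -> : \sum_i ((a i)^* * a i) *: e i = (M ^+ 2)%:C *: \sum_i (h i)%:C *: e i.
  rewrite scaler_sumr; apply: eq_bigr => i _; rewrite -normc_sqE scalerA -rmorphM.
  by rewrite /h expr_div_n [M ^+ 2 * _]mulrC divfK// sqrf_eq0.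
rewrite cnormS normc_real ger0_norm ?sqr_ge0//.
by rewrite -[leRHS]mulr1 ler_wpM2l ?sqr_ge0.
Qed.

(** This makes [calc_cont] applicable to a given homomorphism and the functional calculus of a
    nearby diagonal unitary. *)
Lemma pvm_starhom (l : 'I_N -> @circle R) : is_starhom (fun f : C_circle R => \sum_i f (l i) *: e i).
Proof.
split=> [f g|a f|f g||f].
- by rewrite -big_split; apply: eq_bigr => i _; exact: scalerDl.
- by rewrite scaler_sumr; apply: eq_bigr => i _; rewrite scalerA.
- by rewrite pvm_mul.
- by have [_ _ _ <-] := pe; apply: eq_bigr => i _; rewrite [C_fun 1 _](erefl (1 : R[i])) scale1r.
- by rewrite pvm_star.
Qed.

End Pvm.

Section Projections.
Variables (R : realType) (A : cstarAlgType R).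
Implicit Types (x y e f : A).

Lemma proj_cnorm_le1 e : star e = e -> e * e = e -> cnorm e <= 1.
Proof.
move=> se ee; have := cnorm_sa_sq se; rewrite ee expr2 => h.
have := cnorm_ge0 e; move: (cnorm e) h => r; nra.
Qed.

Lemma proj_cnorm1 e : star e = e -> e * e = e -> e != 0 -> cnorm e = 1.
Proof.
move=> se ee e0; have := cnorm_sa_sq se; rewrite ee expr2 => h.
have n0 : cnorm e != 0 by apply: contra e0 => /eqP/cnorm_eq0 ->.
by apply: (mulIf n0); rewrite -h mul1r.
Qed.

Lemma proj_compl e : star e = e -> e * e = e ->
  star (1 - e) = 1 - e /\ (1 - e) * (1 - e) = 1 - e.
Proof.
move=> se ee; rewrite starB star1 se; split=> //.
by rewrite mulrBr mulr1 mulrBl mul1r ee subrr subr0.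
Qed.

Lemma scale_inj (a b : R[i]) x : x != 0 -> a *: x = b *: x -> a = b.
Proof.
move=> x0 /eqP; rewrite -subr_eq0 -scalerBl scaler_eq0 (negbTE x0) orbF subr_eq0.
by move=> /eqP.
Qed.

Lemma conjc_id (a : R[i]) : a^* = a -> a = (complex.Re a)%:C.
Proof.
case: a => p q /eqP; rewrite eq_complex /= => /andP[_ /eqP q0].
by apply/eqP; rewrite eq_complex /= eqxx; apply/eqP; lra.
Qed.

End Projections.

(** * Polar decomposition of near-unitaries *)

Lemma invsqrt_near1 (R : realType) (t d : R) : 1 / 4 <= t -> `|t - 1| <= d ->
  `|(Num.sqrt t)^-1 - 1| <= 2 * d.
Proof.
move=> t4; have t0 : 0 <= t by lra.
have : 0 <= Num.sqrt t := sqrtr_ge0 t.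
have := sqr_sqrtr t0; move: (Num.sqrt t : R) => r r2 r0.
have r12 : 1 / 2 <= r by nra.
have rp : 0 < r by lra.
have := mulVf (lt0r_neq0 rp); move: (r^-1 : R) => p pr.
have p0 : 0 < p by rewrite -(pmulr_lgt0 _ rp) pr.
have p2 : p <= 2 by have := ler_wpM2l (ltW p0) r12; rewrite pr; lra.
rewrite !ler_norml -r2 => /andP[h1 h2].
have -> : p - 1 = p * (1 - r) by rewrite mulrBr mulr1 pr.
have r1 : 1 - r <= d by nra.
have r3 : - d <= 1 - r by nra.
by apply/andP; split; nra.
Qed.

Section Polar.
Variables (R : realType) (A : cstarAlgType R) (B : set A).
Hypotheses (hB : star_subalgebra B) (fB : fin_dim B) (B1 : B 1).

(** The unitary is the polar part of [x], namely [x] times [k] to the power -1/2 with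
    [k = star x * x], computed on the spectral projections of [k] in [B]. As [k] is within 3d of 1,
    the second factor is within 6d of 1, and (1 + d) 6d + d is at most 8d. *)
Lemma unitary_approx (u x : A) (d : R) : unitary u -> B x -> cnorm (x - u) <= d -> d <= 1 / 20 ->
  exists w, [/\ B w, unitary w & cnorm (w - u) <= 8 * d].
Proof.
move=> [uu uu'] Bx xu d20.
have d0 : 0 <= d := le_trans (cnorm_ge0 _) xu.
have nu : cnorm u <= 1 := cnorm_isometry uu.
have nx : cnorm x <= 1 + d.
  by have := cnormD (x - u) u; rewrite subrK; lra.
pose k := star x * x.
have nk : cnorm (k - 1) <= 3 * d.
  have -> : k - 1 = star x * (x - u) + star (x - u) * u.
    by rewrite -uu starB mulrBr mulrBl addrA subrK.
  apply: le_trans (cnormD _ _) _.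
  have := cnormM (star x) (x - u); have := cnormM (star (x - u)) u; rewrite !cnorm_star.
  have := cnorm_ge0 x; have := cnorm_ge0 u; have := cnorm_ge0 (x - u).
  move: (cnorm _) (cnorm _) (cnorm _) (cnorm _) (cnorm _) xu nu nx => a b c m n; nra.
have sk : star k = k by rewrite /k starM starK.
have Bk : B k by apply: (subalgM hB) => //; exact: subalgS.
have [N [e [l [pe en0 kE _]]]] := spectral_theorem hB fB B1 Bk (congr2 *%R sk (esym sk)).
have [Be se ee e1] := pe.
have ke i : k * e i = l i *: e i by rewrite [in LHS]kE (pvm_mulr pe).
have ne i : cnorm (e i) = 1 by apply: proj_cnorm1 => //; rewrite ee eqxx.
have lr i : l i = (complex.Re (l i))%:C.
  apply: conjc_id; apply: (@scale_inj _ _ _ _ (e i)) => //.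
  have <- : star (e i * (k * e i)) = (l i)^* *: e i by rewrite ke starM starS se -cscalerAl ee eqxx.
  by rewrite starM (starM k) !se sk -mulrA ke -cscalerAr ee eqxx.
pose t i := complex.Re (l i).
have tl i : (t i)%:C = l i by rewrite /t -lr.
have t1 i : `|t i - 1| <= 3 * d.
  apply: le_trans nk; rewrite -normc_real.
  have -> : (t i - 1)%:C = l i - 1 by rewrite -tl rmorphB.
  rewrite -[leLHS]mulr1 -{1}(ne i) -cnormS scalerBl scale1r -ke -{2}[e i]mul1r -mulrBl.
  by apply: le_trans (cnormM _ _) _; rewrite ne mulr1.
pose c i := (Num.sqrt (t i))^-1.
have tp i : 1 / 4 <= t i by have := t1 i; rewrite ler_norml => /andP[]; lra.
have c1 i : `|c i - 1| <= 6 * d.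
  have -> : 6 * d = 2 * (3 * d) by rewrite mulrA; congr (_ * _); ring.
  exact: invsqrt_near1 (tp i) (t1 i).
pose h := \sum_i (c i)%:C *: e i.
have sh : star h = h.
  by rewrite star_sum; apply: eq_bigr => i _; rewrite starSR se.
have hkh : h * k * h = 1.
  rewrite [k]kE !(pvm_mul pe) -[RHS]e1; apply: eq_bigr => i _.
  rewrite -tl -!rmorphM (_ : _ * _ = 1) ?scale1r//.
  have t0 : 0 < t i by have := tp i; lra.
  by rewrite mulrAC /c -invfM -expr2 sqr_sqrtr ?(ltW t0)// mulVf// gt_eqF.
have nh : cnorm (h - 1) <= 6 * d.
  have -> : h - 1 = \sum_i (c i - 1)%:C *: e i.
    rewrite -[in LHS]e1 -sumrB; apply: eq_bigr => i _.
    by rewrite rmorphB scalerBl rmorph1 scale1r.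
  by apply: (pvm_norm pe) => [|i]; rewrite ?mulr_ge0// normc_real.
pose w := x * h.
have ww : star w * w = 1 by rewrite /w starM sh -mulrA (mulrA (star x)) mulrA hkh.
have wu : cnorm (w - u) <= 8 * d.
  have -> : w - u = x * (h - 1) + (x - u) by rewrite mulrBr mulr1 addrA subrK.
  apply: le_trans (cnormD _ _) _; have := cnormM x (h - 1).
  have := cnorm_ge0 x; have := cnorm_ge0 (h - 1).
  move: (cnorm _) (cnorm _) (cnorm _) (cnorm _) xu nh nx => p q r v; nra.
have nw : cnorm w <= 1 := cnorm_isometry ww.
exists w; split=> //.
  by apply: (subalgM hB) => //; apply: (subalg_sum hB) => i _; exact: (subalgZ hB).
(* If nonzero, the projection [1 - w * star w] has norm 1; but it is at most 16d, which is below 1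
   since d is at most 1/20. *)
split=> //; apply/esym/eqP; rewrite -subr_eq0; apply/negPn/negP => p0.
have [sq qq] : star (1 - w * star w) = 1 - w * star w /\
    (1 - w * star w) * (1 - w * star w) = 1 - w * star w.
  apply: proj_compl; first by rewrite starM starK.
  by rewrite -mulrA (mulrA (star w)) ww mul1r.
have := proj_cnorm1 sq qq p0.
have -> : 1 - w * star w = (u - w) * star u + w * star (u - w).
  by rewrite -uu' starB mulrBr mulrBl addrA subrK.
have := cnormD ((u - w) * star u) (w * star (u - w)).
have := cnormM (u - w) (star u); have := cnormM w (star (u - w)).
rewrite !cnorm_star (cnormBC u w); have := cnorm_ge0 w; have := cnorm_ge0 u.
have := cnorm_ge0 (w - u).
move: (cnorm _) (cnorm _) (cnorm _) (cnorm _) (cnorm _) (cnorm _) wu nw nu => p q r v a b; nra.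
Qed.

End Polar.

(** * Minimal projections *)

Section Minimal.
Variables (R : realType) (A : cstarAlgType R) (B : set A).
Hypotheses (hB : star_subalgebra B) (fB : fin_dim B) (B1 : B 1).
Implicit Types (x y e f g : A).

Record minproj e : Prop := {
  mpB : B e; mpS : star e = e; mpM : e * e = e; mp0 : e != 0;
  mp_min : forall g, B g -> star g = g -> g * g = g -> e * g = g -> g != 0 -> g = e
}.

Lemma pvm_bound : exists d, forall N (e : 'I_N -> A), pvm B e -> (forall i, e i != 0) -> (N <= d)%N.
Proof.
have [d hd] := fin_dim_dependent fB; exists d => N e [Be _ ee _] e0.
rewrite leqNgt; apply/negP => dN.
have [c c0 hc] := hd (fun i => e (widen_ord dN i)) (fun i => Be _).
have /rV0Pn[i /eqP] := c0; apply.
apply: (@scale_inj _ _ _ _ (e (widen_ord dN i))) => //; rewrite scale0r.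
move/(congr1 (fun x => x * e (widen_ord dN i))): hc.
rewrite mul0r mulr_suml (bigD1 i)//= -cscalerAl ee eqxx big1 ?addr0// => j ji.
have wji : (widen_ord dN j == widen_ord dN i) = false by rewrite -val_eqE /= val_eqE (negbTE ji).
by rewrite -cscalerAl ee wji scaler0.
Qed.

(* A refinement of maximal length consists of minimal projections. *)
Lemma pvm_refine (X : Type) N (e : 'I_N -> A) (l : 'I_N -> X) :
  pvm B e -> (forall i, e i != 0) ->
  exists N' (e' : 'I_N' -> A) (l' : 'I_N' -> X),
    [/\ pvm B e', forall i, minproj (e' i) &
        forall F : X -> R[i], \sum_i F (l' i) *: e' i = \sum_i F (l i) *: e i].
Proof.
move=> pe e0; pose Q n := exists (e' : 'I_n -> A) (l' : 'I_n -> X),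
    [/\ pvm B e', forall i, e' i != 0 &
        forall F : X -> R[i], \sum_i F (l' i) *: e' i = \sum_i F (l i) *: e i].
have exQ : exists n, `[< Q n >] by exists N; apply/asboolP; exists e, l.
have [d hd] := pvm_bound.
have ubQ n : `[< Q n >] -> (n <= d)%N by move=> /asboolP[e' [l' [h h' _]]]; exact: hd h h'.
have [n /asboolP[e' [l' [pe' e'0 sumE]]] maxn] := ex_maxnP exQ ubQ.
exists n, e', l'; split=> // a; have [Be se ee e1] := pe'.
split=> //; first by rewrite ee eqxx.
move=> g Bg sg gg eg g0; apply/eqP; rewrite -subr_eq0; apply/negPn/negP => ge.
have ge' : g * e' a = g by move/(congr1 (@star _ _)): eg; rewrite starM sg se.
suff /asboolP/maxn : Q n.+1 by rewrite ltnn.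
pose h := e' a - g.
have h0 : h != 0 by rewrite -oppr_eq0 opprB.
have sh : star h = h by rewrite starB se sg.
have hh : h * h = h by rewrite mulrBr !mulrBl ee eqxx ge' eg gg subrr subr0.
have gh : g * h = 0 by rewrite mulrBr ge' gg subrr.
have hg : h * g = 0 by rewrite mulrBl eg gg subrr.
have eh : e' a * h = h by rewrite mulrBr ee eqxx eg.
have he : h * e' a = h by rewrite mulrBl ee eqxx ge'.
have orth j : j != a -> [/\ g * e' j = 0, e' j * g = 0, h * e' j = 0 & e' j * h = 0].
  move=> ja; split.
  - by rewrite -ge' -mulrA ee eq_sym (negbTE ja) mulr0.
  - by rewrite -eg mulrA ee (negbTE ja) mul0r.
  - by rewrite -he -mulrA ee eq_sym (negbTE ja) mulr0.
  - by rewrite -eh mulrA ee (negbTE ja) mul0r.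
(* The new slot [ord0] receives [g], and the slot of [a] keeps the remainder [h]; both carry the
   label of [a]. *)
pose e2 (i : 'I_n.+1) := if unlift ord0 i is Some j then (if j == a then h else e' j) else g.
pose l2 (i : 'I_n.+1) := if unlift ord0 i is Some j then l' j else l' a.
have e2S j : e2 (lift ord0 j) = if j == a then h else e' j by rewrite /e2 liftK.
have l2S j : l2 (lift ord0 j) = l' j by rewrite /l2 liftK.
have e20 : e2 ord0 = g by rewrite /e2 unlift_none.
have l20 : l2 ord0 = l' a by rewrite /l2 unlift_none.
have sum2 F : \sum_i F (l2 i) *: e2 i = \sum_i F (l' i) *: e' i.
  rewrite big_ord_recl e20 l20 (bigD1 a)//= e2S l2S eqxx [RHS](bigD1 a)//= addrA -scalerDr.
  rewrite [g + h]addrC subrK; congr (_ + _); apply: eq_bigr => j ja.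
  by rewrite e2S l2S (negbTE ja).
exists e2, l2; split; last by move=> F; rewrite sum2 sumE.
  split.
  - move=> i; rewrite /e2; case: unliftP => // j _; case: ifP => // _.
    exact: (subalgB hB).
  - by move=> i; rewrite /e2; case: unliftP => // j _; case: ifP.
  - move=> i j; case: (unliftP ord0 i) => [i' ->|->]; case: (unliftP ord0 j) => [j' ->|->];
      rewrite ?e2S ?e20 ?(inj_eq lift_inj) ?eqxx ?gg//.
    + case: (i' =P a) => [->|/eqP ia]; case: (j' =P a) => [->|/eqP ja]; rewrite ?eqxx ?hh//.
      * by rewrite eq_sym (negbTE ja); have [] := orth _ ja.
      * by rewrite (negbTE ia); have [] := orth _ ia.
    + by rewrite [lift _ _ == _]eq_sym (negbTE (neq_lift _ _)); case: eqP => [_|/eqP /orth[]].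
    + by rewrite (negbTE (neq_lift _ _)); case: eqP => [_|/eqP /orth[]].
  - move: (sum2 (fun=> 1)); under eq_bigr do rewrite scale1r; move=> ->.
    by under eq_bigr do rewrite scale1r.
by move=> i; rewrite /e2; case: unliftP => // j _; case: ifP.
Qed.

(** The spectral projections of [x] commute with [e] and sum to 1, so one of them has a nonzero
    product with [e]; by minimality this product is [e], and [x] acts on it by an eigenvalue. *)
Lemma minproj_sa_scalar e x : minproj e -> B x -> star x = x -> e * x = x ->
  exists c : R[i], x = c *: e.
Proof.
move=> me Bx sx ex.
have xe : x * e = x by move/(congr1 (@star _ _)): ex; rewrite starM sx (mpS me).
have [N [p [l [pp _ xE pcomm]]]] := spectral_theorem hB fB B1 Bx (congr2 *%R sx (esym sx)).
have [Bp sp pp' p1] := pp.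
have ep i : e * p i = p i * e by apply: pcomm; rewrite ex xe.
have [i epi] : exists i, e * p i != 0.
  apply: contrapT => h; have := mp0 me; rewrite -[e]mulr1 -p1 mulr_sumr big1 ?eqxx// => i _.
  by apply/eqP/negPn/negP => ei; apply: h; exists i.
have epe : e * p i = e.
  apply: (mp_min me) => //; first by apply: (subalgM hB) => //; exact: mpB me.
  - by rewrite starM sp (mpS me).
  - by rewrite -mulrA (mulrA (p i)) -ep -mulrA pp' eqxx mulrA (mpM me).
  - by rewrite mulrA (mpM me).
exists (l i); rewrite -[LHS]xe -[in LHS]epe ep mulrA [in LHS]xE (pvm_mulr pp).
by rewrite -cscalerAl -ep epe.
Qed.

Lemma minproj_scalar e x : minproj e -> B x -> e * x = x -> x * e = x ->
  exists c : R[i], x = c *: e.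
Proof.
move=> me Bx ex xe; have se := mpS me.
have esx : e * star x = star x by rewrite -[e in LHS]se -starM xe.
have Bsx := subalgS hB Bx.
have [|||a ha] := minproj_sa_scalar (x := x + star x) me.
- exact: (subalgD hB).
- by rewrite starD starK addrC.
- by rewrite mulrDr ex esx.
have [|||b hb] := minproj_sa_scalar (x := 'i *: (x - star x)) me.
- by apply: (subalgZ hB); exact: (subalgB hB).
- rewrite starS starB starK -opprB scalerN -scaleNr; congr (_ *: _).
  by apply/eqP; rewrite eq_complex /= oppr0 opprK !eqxx.
- by rewrite -cscalerAr mulrBr ex esx.
exists (2^-1 * (a - 'i * b)); rewrite -scalerA scalerBl -ha -scalerA -hb scalerA.
rewrite -expr2 sqr_i scaleN1r opprK addrACA subrr addr0 -mulr2n -[x *+ 2]scaler_nat scalerA.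
by rewrite mulVf ?scale1r// pnatr_eq0.
Qed.

Definition mvn e f := exists v, [/\ B v, star v * v = e & v * star v = f].

(** Both products are scalar by [minproj_scalar], and bracketing [y * star y * y] in two ways
    equates the scalars. The sign of [r] is settled in [minproj_mvn]. *)
Lemma minproj_corner e f y : minproj e -> minproj f -> B y -> f * y = y -> y * e = y -> y != 0 ->
  exists r : R, [/\ r != 0, star y * y = r%:C *: e & y * star y = r%:C *: f].
Proof.
move=> me mf By fy ye y0.
have esy : e * star y = star y by rewrite -[e in LHS](mpS me) -starM ye.
have syf : star y * f = star y by rewrite -[f in LHS](mpS mf) -starM fy.
have Bsy := subalgS hB By.
have [||| c hc] := minproj_scalar (x := star y * y) me.
- exact: (subalgM hB).
- by rewrite mulrA esy.
- by rewrite -mulrA ye.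
have [||| c' hc'] := minproj_scalar (x := y * star y) mf.
- exact: (subalgM hB).
- by rewrite mulrA fy.
- by rewrite -mulrA syf.
have cc : c = c'.
  by apply: (scale_inj y0); rewrite -{1}ye cscalerAr -hc mulrA hc' -cscalerAl fy.
have cr : c = (complex.Re c)%:C.
  apply: conjc_id; apply: (scale_inj (mp0 me)).
  by rewrite -hc -[in LHS](mpS me) -starS -hc starM starK.
exists (complex.Re c); rewrite -cr; split=> //; last by rewrite cc.
apply/eqP => c0; move: hc; rewrite cr c0 scale0r => /star_mul_eq0 yy.
by rewrite yy eqxx in y0.
Qed.

(** Dividing by the square root of the scalar from [minproj_corner] gives the partial isometry, so
    the point is that this scalar is positive; norm estimates show it. *)
Lemma minproj_mvn e f y : minproj e -> minproj f -> B y -> f * y = y -> y * e = y -> y != 0 ->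
  mvn e f.
Proof.
move=> me mf By fy ye y0; have [ne nf] := (proj_cnorm1 (mpS me) (mpM me) (mp0 me),
  proj_cnorm1 (mpS mf) (mpM mf) (mp0 mf)).
have pos z r : B z -> star z * z = r%:C *: e -> z * star z = r%:C *: f -> 0 < r -> mvn e f.
  move=> Bz h1 h2 r0; pose s := (Num.sqrt r)^-1.
  have ss : s%:C * s%:C * r%:C = 1 :> R[i].
    by rewrite -!rmorphM /s -invfM -expr2 sqr_sqrtr ?(ltW r0)// mulVf ?gt_eqF ?rmorph1.
  exists (s%:C *: z); split; first exact: (subalgZ hB).
    by rewrite starSR -cscalerAl -cscalerAr h1 !scalerA ss scale1r.
  by rewrite starSR -cscalerAl -cscalerAr h2 !scalerA ss scale1r.
(* If [f * e] is nonzero, it replaces [y]: with x = (1 - f) e, the element [star x * x] is (1 - r) e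
   and has norm at most 1, so r >= 0. *)
have [fe0|fe0] := eqVneq (f * e) 0; last first.
  have Bfe : B (f * e) by apply: (subalgM hB); [exact: mpB mf|exact: mpB me].
  have [||r [r0 h1 h2]] := minproj_corner me mf Bfe _ _ fe0.
  - by rewrite mulrA (mpM mf).
  - by rewrite -mulrA (mpM me).
  apply: (pos _ _ Bfe h1 h2).
  have [s1 p1] := proj_compl (mpS mf) (mpM mf).
  have : cnorm (star ((1 - f) * e) * ((1 - f) * e)) <= 1.
    rewrite cnorm_starM exprn_ile1 ?cnorm_ge0//; apply: le_trans (cnormM _ _) _.
    by rewrite ne mulr1 proj_cnorm_le1.
  have -> : star ((1 - f) * e) * ((1 - f) * e) = (1 - r)%:C *: e.
    rewrite starM s1 (mpS me) -mulrA (mulrA (1 - f)) p1 rmorphB rmorph1 scalerBl scale1r -h1.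
    rewrite starM (mpS me) (mpS mf) -mulrA (mulrA f) (mpM mf) mulrBl mul1r mulrBr (mpM me).
    by [].
  rewrite cnormS ne mulr1 normc_real ler_norml => /andP[_ ?].
  by rewrite lt_def r0; lra.
have [r [r0 h1 h2]] := minproj_corner me mf By fy ye y0.
have [|r0'] := ltP 0 r; first exact: pos h1 h2.
have rp : 0 < - r by rewrite oppr_gt0 lt_def eq_sym r0.
(* If the sign were negative, h = y + y^* would satisfy h^2 = -g for a projection g = e + f, and
   averaging the squares of the contractions 1 + ih and 1 - ih would give |1 + g| <= 1. *)
pose s := (Num.sqrt (- r))^-1; pose h := s%:C *: (y + star y).
have ef0 : e * f = 0 by move/(congr1 (@star _ _)): fe0; rewrite starM star0 (mpS me) (mpS mf).
have yy : y * y = 0 by rewrite -{1}ye -{2}fy -mulrA (mulrA e) ef0 mul0r mulr0.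
have sysy : star y * star y = 0 by rewrite -starM yy star0.
have sh : star h = h by rewrite starSR starD starK addrC.
have hh : h * h = - (e + f).
  rewrite /h -cscalerAl -cscalerAr scalerA mulrDl !mulrDr yy sysy add0r addr0 h1 h2.
  rewrite -scalerDr scalerA -!rmorphM (_ : _ * _ = -1) ?rmorphN1 ?scaleN1r 1?addrC//.
  by rewrite -[r in LHS]opprK mulrN /s -invfM -expr2 sqr_sqrtr ?(ltW rp)// mulVf ?gt_eqF.
pose g := e + f.
have sg : star g = g by rewrite starD (mpS me) (mpS mf).
have gg : g * g = g by rewrite mulrDl !mulrDr (mpM me) (mpM mf) fe0 ef0 addr0 add0r.
have [s1 p1] := proj_compl sg gg.
have I a : a = 'i \/ a = - 'i -> cnorm (1 + a *: h) <= 1.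
  move=> ha; apply: cnorm_le_sq => //; rewrite expr1n.
  have aJ : a^* = - a by case: ha => ->; apply/eqP; rewrite eq_complex /= ?oppr0 ?opprK !eqxx.
  have aa : a * a = -1 by case: ha => ->; rewrite ?mulrNN -expr2; exact: sqr_i.
  rewrite starD starS sh aJ star1 scaleNr mulrBl mul1r mulrDr mulr1.
  rewrite -cscalerAl -cscalerAr scalerA aa scaleN1r hh opprK.
  rewrite opprD addrA addrK; exact: proj_cnorm_le1.
have I2 a : a = 'i \/ a = - 'i -> cnorm ((1 + a *: h) * (1 + a *: h)) <= 1.
  move=> /I h'; apply: le_trans (cnormM _ _) _.
  by rewrite -[leRHS]mulr1 ler_pM ?cnorm_ge0.
have sq a : a = 'i \/ a = - 'i -> (1 + a *: h) * (1 + a *: h) = 1 + g + a *: (h + h).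
  move=> ha; have aa : a * a = -1 by case: ha => ->; rewrite ?mulrNN -expr2; exact: sqr_i.
  rewrite mulrDl mul1r mulrDr mulr1 -cscalerAl -cscalerAr scalerA aa scaleN1r hh opprK.
  by rewrite scalerDr -/g addrA addrAC (addrAC 1) -(addrA (1 + g)).
have := cnormD ((1 + 'i *: h) * (1 + 'i *: h)) ((1 + - 'i *: h) * (1 + - 'i *: h)).
have i1 := I2 'i (or_introl erefl); have i2 := I2 (- 'i) (or_intror erefl).
have -> : (1 + 'i *: h) * (1 + 'i *: h) + (1 + - 'i *: h) * (1 + - 'i *: h) = (2 : R)%:C *: (1 + g).
  rewrite !sq; [|by right|by left].
  by rewrite addrACA scaleNr subrr addr0 -mulr2n -scaler_nat rmorph_nat.
rewrite cnormS normc_real ger0_norm// => h3.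
(* The averaging bounds the norm of [1 + g] by 1, whereas [(1 + g) * e] is twice [e], of norm 2. *)
have := cnormM (1 + g) e; rewrite ne mulr1.
have -> : (1 + g) * e = (2 : R)%:C *: e.
  by rewrite mulrDl mul1r /g mulrDl (mpM me) fe0 addr0 -mulr2n -scaler_nat rmorph_nat.
rewrite cnormS normc_real ger0_norm// ne.
move: (cnorm _) (cnorm _) (cnorm _) i1 i2 h3 => p q k; clear => *; lra.
Qed.

End Minimal.

(** * Matching *)

Section Hall.
Variables (I J : finType).
Implicit Types (r : I -> J -> bool) (T : {set I}).

Definition nbh r T : {set J} := [set j | [exists i in T, r i j]]%SET.

Lemma nbhP r T j : reflect (exists2 i, i \in T & r i j) (j \in nbh r T).
Proof. by rewrite inE; apply: (iffP exists_inP). Qed.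

(* Induction on the number of edges: when a vertex has two neighbours, one of the two edges can be
   removed, by submodularity of the neighbourhood size. *)
Lemma hall_marriage r : (forall T, #|T| <= #|nbh r T|)%N ->
  exists s : I -> J, injective s /\ forall i, r i (s i).
Proof.
have [n] := ubnP #|[set p : I * J | r p.1 p.2]%SET|; elim: n r => // n IH r rn hall.
case: (pselect (exists i j1 j2, [/\ j1 != j2, r i j1 & r i j2])) => [[i [j1 [j2 [j12 r1 r2]]]]|uniq_r].
  pose del j i' j' := r i' j' && ~~ ((i' == i) && (j' == j)).
  have del_ok j : r i j -> (forall T, #|T| <= #|nbh (del j) T|)%N ->
      exists s : I -> J, injective s /\ forall i, r i (s i).
    move=> rij /IH[|s [si sr]]; last by exists s; split=> // k; have /andP[] := sr k.
    rewrite -ltnS; apply: leq_trans rn; rewrite ltnS; apply: proper_card.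
    apply/properP; split; first by apply/fintype.subsetP => -[a b]; rewrite !inE => /andP[].
    by exists (i, j); rewrite !inE //= /del !eqxx andbF.
  have [h1|/existsNP[T1 /negP]] := pselect (forall T, #|T| <= #|nbh (del j1) T|)%N.
    exact: del_ok h1.
  have [h2|/existsNP[T2 /negP]] := pselect (forall T, #|T| <= #|nbh (del j2) T|)%N.
    by move=> _; exact: del_ok h2.
  rewrite -!ltnNge => v2 v1; exfalso.
  have inT j T : (#|nbh (del j) T| < #|T|)%N -> i \in T.
    apply: contraLR => iT; rewrite -leqNgt; apply: leq_trans (hall T) _.
    apply: subset_leq_card; apply/fintype.subsetP => k /nbhP[a aT rak]; apply/nbhP; exists a => //.
    by rewrite /del rak /=; apply: contra iT => /andP[/eqP <-].
  have [i1 i2] := (inT _ _ v1, inT _ _ v2).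
  have U : nbh r (T1 :|: T2) \subset nbh (del j1) T1 :|: nbh (del j2) T2.
    apply/fintype.subsetP => k /nbhP[a aT rak]; rewrite inE.
    have [ai|ai] := eqVneq a i.
      have [kj|kj] := eqVneq k j1.
        apply/orP; right; apply/nbhP; exists i => //.
        by rewrite /del -ai rak /= ai eqxx kj j12.
      apply/orP; left; apply/nbhP; exists i => //.
      by rewrite /del -ai rak /= ai eqxx kj.
    move: aT; rewrite inE => /orP[aT|aT]; apply/orP; [left|right]; apply/nbhP; exists a => //;
      by rewrite /del rak (negbTE ai).
  have V : nbh r ((T1 :&: T2) :\ i) \subset nbh (del j1) T1 :&: nbh (del j2) T2.
    apply/fintype.subsetP => k /nbhP[a]; rewrite !finset.in_setD1 finset.in_setI => /and3P[ai a1 a2] rak.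
    by rewrite finset.in_setI; apply/andP; split; apply/nbhP; exists a => //; rewrite /del rak (negbTE ai).
  (* Hall's condition with [U] and [V] bounds the two neighbourhood sizes together from below by
     |T1| + |T2| - 1, while the two violations bound them from above by |T1| + |T2| - 2. *)
  have := leq_add (leq_trans (hall _) (subset_leq_card U)) (leq_trans (hall _) (subset_leq_card V)).
  rewrite cardsUI; have := cardsUI T1 T2; have := cardsD1 i (T1 :&: T2).
  rewrite finset.in_setI i1 i2 /=; move: v1 v2.
  move: #|T1| #|T2| #|_ :|: _| #|_ :&: _| #|_ :\ i| #|nbh _ T1| #|nbh _ T2| => a b c d e f g.
  lia.
(* Now each vertex has exactly one neighbour; two vertices sharing it would violate Hall's
   condition. *)
have ex i : exists j, r i j.
  have := hall [set i]%SET; rewrite cards1 => /card_gt0P[j /nbhP[k]].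
  by rewrite inE => /eqP -> rij; exists j.
have [s sr] := choice ex; exists s; split=> // i1 i2 s12; apply/eqP/negPn/negP => i12.
have := hall [set i1; i2]%SET; rewrite cards2 i12; apply/negP; rewrite -ltnNge ltnS.
apply: leq_trans (_ : #|[set s i1]%SET| <= _)%N; last by rewrite cards1.
apply: subset_leq_card; apply/fintype.subsetP => j /nbhP[k kT rkj]; rewrite inE.
have ks : s k = s i1 by move: kT; rewrite !inE => /orP[/eqP ->|/eqP ->].
rewrite -ks; apply/negPn/negP => js; apply: uniq_r; exists k, j, (s k); split=> //.
Qed.

End Hall.

Lemma strict_contraction0 (R : realFieldType) (p q y : R) :
  p < 1 -> 0 <= y -> q <= y * p -> y ^+ 2 <= q * y -> y = 0.
Proof.
rewrite expr2 => p1 y0 qyp yq; apply/eqP; rewrite eq_le y0 andbT leNgt; apply/negP => yp.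
have := ler_wpM2r y0 qyp; have : 0 < y * y * (1 - p) by rewrite !mulr_gt0// subr_gt0.
nra.
Qed.

(** * Rank comparison inside a Murray-von Neumann class *)

Section Comparison.
Variables (R : realType) (A : cstarAlgType R) (B : set A).
Hypotheses (hB : star_subalgebra B) (fB : fin_dim B) (B1 : B 1).
Implicit Types (x y e f : A).

Lemma isometry_src e v : star e = e -> e * e = e -> star v * v = e -> v * e = v.
Proof.
move=> se ee vv; apply/eqP; rewrite -subr_eq0; apply/eqP; apply: star_mul_eq0.
rewrite starB starM se mulrBl !mulrBr -!mulrA (mulrA (star v) v) vv.
by rewrite !ee !subrr.
Qed.

Lemma isometry_tgt f v : star f = f -> f * f = f -> v * star v = f -> f * v = v.
Proof.
move=> sf ff vv; have := @isometry_src f (star v) sf ff.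
by rewrite starK vv => /(_ erefl) /(congr1 (@star _ _)); rewrite starM !starK sf.
Qed.

Lemma mvn_sym e f : mvn B e f -> mvn B f e.
Proof. by move=> [v [Bv h k]]; exists (star v); rewrite starK; split=> //; exact: subalgS. Qed.

Lemma mvn_trans e f g : minproj B e -> minproj B f -> minproj B g ->
  mvn B e f -> mvn B f g -> mvn B e g.
Proof.
move=> me mf mg [v [Bv v1 v2]] [w [Bw w1 w2]]; exists (w * v); split; first exact: (subalgM hB).
  rewrite starM mulrA -(mulrA (star v)) w1 -mulrA.
  by rewrite (isometry_tgt (mpS mf) (mpM mf) v2).
by rewrite starM mulrA -(mulrA w) v2 (isometry_src (mpS mf) (mpM mf) w1).
Qed.

Section Rank.
Variables (N M : nat) (e : 'I_N -> A) (f : 'I_M -> A) (a : 'I_N -> R[i]) (b : 'I_M -> R[i]).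
Hypotheses (pe : pvm B e) (pf : pvm B f).
Hypotheses (me : forall i, minproj B (e i)) (mf : forall j, minproj B (f j)).

(* Otherwise a kernel vector of the coefficient matrix yields Y <> 0 in e0 B (sum of the e_i, i in T)
   with Y r (sum_j b_j f_j) = 0, and the hypothesis gives |Y|^2 <= d |Y|^2 with d < 1. *)
Lemma comparison_card (r e0 : A) (T : {set 'I_N}) : B r ->
  cnorm (r * (\sum_j b j *: f j) * star r - \sum_i a i *: e i) < 1 ->
  minproj B e0 -> (forall i, i \in T -> mvn B e0 (e i) /\ a i = 1) ->
  (#|T| <= #|[set j | `[< mvn B e0 (f j) >] && (b j != 0%R)]%SET|)%N.
Proof.
move=> Br hr m0 hT; set S := [set _ | _]%SET; rewrite leqNgt; apply/negP => ST.
have [_ _ ee _] := pe; have [_ _ _ f1] := pf.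
have /choice[v hv] : forall i, exists v, i \in T -> [/\ B v, star v * v = e0 & v * star v = e i].
  move=> i; case: (boolP (i \in T)) => [/hT[[v hv] _]|_]; last by exists 0.
  by exists v.
have /choice[w hw] : forall j, exists w, j \in S -> [/\ B w, star w * w = e0 & w * star w = f j].
  move=> j; case: (boolP (j \in S)) => [|_]; last by exists 0.
  by rewrite inE => /andP[/asboolP[w hw] _]; exists w.
pose vv (i : 'I_#|T|) := v (enum_val i); pose ww (j : 'I_#|S|) := w (enum_val j).
have hvv (i : 'I_#|T|) := hv _ (enum_valP i); have hww (j : 'I_#|S|) := hw _ (enum_valP j).
have ve i : vv i * e0 = vv i.
  by have [_ h _] := hvv i; exact: isometry_src (mpS m0) (mpM m0) h.
have ev i : e (enum_val i) * vv i = vv i.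
  by have [_ _ h] := hvv i; exact: isometry_tgt (mpS (me _)) (mpM (me _)) h.
have we j : ww j * e0 = ww j.
  by have [_ h _] := hww j; exact: isometry_src (mpS m0) (mpM m0) h.
have esv i : e0 * star (vv i) = star (vv i) by rewrite -[e0 in LHS](mpS m0) -starM ve.
have sve i : star (vv i) * e (enum_val i) = star (vv i).
  by rewrite -[e _ in LHS](mpS (me _)) -starM ev.
(* [e0 B e0] consists of multiples of [e0], so moving [r] into this corner along the partial
   isometries yields a matrix of scalars. *)
have /choice[X hX] : forall p : 'I_#|T| * 'I_#|S|, exists c : R[i],
    star (vv p.1) * r * ww p.2 = c *: e0.
  move=> [i j] /=; apply: (minproj_scalar hB fB B1 m0).
  - have [Bv _ _] := hvv i; have [Bw _ _] := hww j.
    by apply: (subalgM hB) => //; apply: (subalgM hB) => //; exact: subalgS.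
  - by rewrite !mulrA esv.
  - by rewrite -mulrA we.
have [c c0 cX] := left_kernel (\matrix_(i, j) X (i, j)) ST.
pose Y := \sum_i c 0 i *: star (vv i).
have eY : e0 * Y = Y.
  by rewrite mulr_sumr; apply: eq_bigr => i _; rewrite -cscalerAr esv.
have BY : B Y.
  by apply: (subalg_sum hB) => i _; apply: (subalgZ hB); apply: (subalgS hB); have [] := hvv i.
(* For [j] in [S] this is the kernel equation; for [j] outside, a nonzero product would make [e0]
   and [f j] equivalent by [minproj_mvn]. *)
have Yf j : b j != 0 -> Y * r * f j = 0.
  move=> bj; case: (boolP (j \in S)) => jS; last first.
    apply/eqP/negPn/negP => Y0; move: jS; rewrite inE bj andbT => /asboolP; apply.
    apply: (minproj_mvn hB fB B1 (y := star (Y * r * f j))) => //.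
    - apply: (subalgS hB); apply: (subalgM hB); last exact: (mpB (mf _)).
      exact: (subalgM hB).
    - by rewrite (starM _ (f j)) (mpS (mf j)) mulrA (mpM (mf j)).
    - by rewrite -mulrA starM -mulrA -[e0 in LHS](mpS m0) -(starM e0) eY.
    - by apply: contra Y0 => /eqP/(congr1 (@star _ _)); rewrite starK star0 => ->.
  have [Bw _ <-] := hw _ jS; rewrite mulrA.
  suff -> : Y * r * w j = 0 by rewrite mul0r.
  rewrite /Y !mulr_suml; pose j' := enum_rank_in jS j.
  have jE : w j = ww j' by rewrite /ww enum_rankK_in.
  under eq_bigr => i _ do rewrite jE -!cscalerAl (hX (i, j')) scalerA.
  rewrite -scaler_suml; have /rowP/(_ j') := cX; rewrite !mxE.
  by under eq_bigr do rewrite mxE; move=> ->; rewrite scale0r.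
have Yr : Y * r * (\sum_j b j *: f j) = 0.
  rewrite mulr_sumr big1// => j _; rewrite -cscalerAr.
  by have [->|/Yf ->] := eqVneq (b j) 0; rewrite ?scale0r ?scaler0.
have Ya : Y * (\sum_i a i *: e i) = Y.
  rewrite mulr_suml; apply: eq_bigr => i _; rewrite -cscalerAl; congr (_ *: _).
  rewrite mulr_sumr (bigD1 (enum_val i))//= big1 ?addr0 => [|k ki].
    by have [_ ->] := hT _ (enum_valP i); rewrite scale1r sve.
  by rewrite -(sve i) -cscalerAr -mulrA ee eq_sym (negbTE ki) mulr0 scaler0.
have Y0 : Y = 0.
  apply: cnorm_eq0; move: hr; set d := _ - _ => hr.
  have : Y * d * star Y = - (Y * star Y).
    by rewrite mulrBr mulrBl Ya !mulrA Yr !mul0r sub0r.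
  move=> /(congr1 (@cnorm _ _)); rewrite cnormN cnorm_starM' => h.
  have := cnormM (Y * d) (star Y); rewrite h cnorm_star.
  have := cnormM Y d; have := cnorm_ge0 Y; have := cnorm_ge0 d.
  by move=> _ y0 qyp yq; exact: (strict_contraction0 hr y0 qyp yq).
have /rV0Pn[k /eqP] := c0; apply; apply: (@scale_inj _ _ _ _ e0 (mp0 m0)); rewrite scale0r.
move: Y0 => /(congr1 (fun y => y * vv k)); rewrite mul0r mulr_suml (bigD1 k)//= -cscalerAl.
have [_ -> _] := hvv k; rewrite big1 ?addr0// => i ik.
rewrite -cscalerAl -(sve i) -mulrA -(ev k) (mulrA (e _)) ee (inj_eq enum_val_inj) (negbTE ik).
by rewrite mul0r mulr0 scaler0.
Qed.

End Rank.
End Comparison.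

Section Matching.
Variables (R : realType) (A : cstarAlgType R) (B : set A).
Hypotheses (hB : star_subalgebra B) (fB : fin_dim B) (B1 : B 1).

(** Hall's condition is checked by splitting off one Murray-von Neumann class [T0] of [T] at a time:
    [comparison_card] counts within a class, and distinct classes have disjoint neighbourhoods, so
    the counts add up. *)
Lemma pvm_matching N M (e : 'I_N -> A) (f : 'I_M -> A) (close : 'I_N -> 'I_M -> bool) :
  pvm B e -> pvm B f -> (forall i, minproj B (e i)) -> (forall j, minproj B (f j)) ->
  (forall T : {set 'I_N}, T != finset.set0 -> exists a b r, [/\ B r,
     cnorm (r * (\sum_j b j *: f j) * star r - \sum_i a i *: e i) < 1,
     forall i, i \in T -> a i = 1 & forall j, b j != 0 -> exists2 i, i \in T & close i j]) ->
  exists s : 'I_N -> 'I_M, injective s /\ forall i, mvn B (e i) (f (s i)) /\ close i (s i).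
Proof.
move=> pe pf me mf H; pose rel i j := `[< mvn B (e i) (f j) >] && close i j.
suff hall (T : {set 'I_N}) : (#|T| <= #|nbh rel T|)%N.
  have [s [si sr]] := hall_marriage hall; exists s; split=> // i.
  by have /andP[/asboolP] := sr i.
have [n] := ubnP #|T|; elim: n T => // n IH T Tn.
have [->|[i0 i0T]] := finset.set_0Vmem T; first by rewrite cards0.
pose T0 := [set i in T | `[< mvn B (e i0) (e i) >]]%SET.
have i00 : i0 \in T0.
  rewrite inE i0T; apply/asboolP; exists (e i0); split; first exact: mpB.
    by rewrite (mpS (me _)) (mpM (me _)).
  by rewrite (mpS (me _)) (mpM (me _)).
have T00 : T0 != finset.set0 by apply/finset.set0Pn; exists i0.
have [a [b [r [Br hr ha hb]]]] := H T0 T00.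
have c0 : (#|T0| <= #|nbh rel T0|)%N.
  apply: leq_trans (comparison_card hB fB B1 pe pf me mf (T := T0) Br hr (me i0) _) _.
    by move=> i iT; split; [move: iT; rewrite inE => /andP[_ /asboolP]|exact: ha].
  apply: subset_leq_card; apply/fintype.subsetP => j; rewrite inE => /andP[/asboolP m0 /hb[i iT ij]].
  apply/nbhP; exists i => //; rewrite /rel ij andbT; apply/asboolP.
  move: iT; rewrite inE => /andP[_ /asboolP mi].
  exact: (mvn_trans hB (me i) (me i0) (mf j) (mvn_sym hB mi) m0).
have c1 : (#|T :\: T0| <= #|nbh rel (T :\: T0)|)%N.
  apply: IH; rewrite -ltnS; apply: leq_trans Tn; rewrite ltnS; apply: proper_card.
  by apply/properP; split; [exact: finset.subsetDl|exists i0; rewrite // inE i00].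
rewrite -(cardsID T0 T) (_ : T :&: T0 = T0); last first.
  by apply/finset.setIidPr/fintype.subsetP => i; rewrite inE => /andP[].
apply: leq_trans (leq_add c0 c1) _; rewrite -cardsUI (_ : _ :&: _ = finset.set0) ?cards0 ?addn0.
  apply: subset_leq_card; apply/fintype.subsetP => j; rewrite inE => /orP[] /nbhP[i iT ij];
    apply/nbhP; exists i => //; move: iT; rewrite inE => /andP[]//.
apply/finset.setP => j; rewrite !inE; apply/negbTE/negP => /andP[/exists_inP[i iT /andP[/asboolP ij _]]].
move=> /exists_inP[k kT /andP[/asboolP kj _]].
move: kT; rewrite !inE => /andP[/negP + kT]; apply; rewrite kT; apply/asboolP.
move: iT; rewrite inE => /andP[_ /asboolP mi].
apply: (mvn_trans hB (me i0) (me i) (me k) mi).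
exact: (mvn_trans hB (me i) (mf j) (me k) ij (mvn_sym hB kj)).
Qed.

(** The comparison of 1 with itself, every pair counting as close. It makes the injective matching
    bijective, as required for [w] to be unitary. *)
Lemma pvm_card_le N M (e : 'I_N -> A) (f : 'I_M -> A) :
  pvm B e -> pvm B f -> (forall i, minproj B (e i)) -> (forall j, minproj B (f j)) -> (N <= M)%N.
Proof.
move=> pe pf me mf.
have [|s [si _]] := @pvm_matching _ _ e f (fun _ _ => true) pe pf me mf.
  move=> T /finset.set0Pn[i iT]; exists (fun=> 1), (fun=> 1), 1; split=> //; last by move=> j _; exists i.
  under eq_bigr do rewrite scale1r; under [X in _ - X]eq_bigr do rewrite scale1r.
  have [_ _ _ ->] := pe; have [_ _ _ ->] := pf.
  by rewrite star1 !mulr1 subrr cnorm0.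
by have := leq_card s si; rewrite !card_ord.
Qed.

Lemma matched_unitary N M (e : 'I_N -> A) (f : 'I_M -> A) (s : 'I_N -> 'I_M)
    (l : 'I_N -> R[i]) (m : 'I_M -> R[i]) (eps : R) :
  pvm B e -> pvm B f -> (forall i, minproj B (e i)) -> (forall j, minproj B (f j)) ->
  injective s -> (forall i, mvn B (e i) (f (s i))) -> 0 <= eps ->
  (forall i, normc (l i - m (s i)) <= eps) ->
  exists2 w : A, unitary w &
    cnorm (w * (\sum_i l i *: e i) * star w - \sum_j m j *: f j) <= eps.
Proof.
move=> pe pf me mf si hs eps0 hl.
have MN := pvm_card_le pf pe mf me.
have sb : bijective s by apply: inj_card_bij => //; rewrite !card_ord.
have reS (F : 'I_M -> A) : \sum_j F j = \sum_i F (s i).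
  by rewrite (reindex s)//; apply: onW_bij.
have [Be se ee e1] := pe; have [Bf sf ff f1] := pf.
have /choice[v hv] := hs.
have ve i : v i * e i = v i by have [_ h _] := hv i; exact: isometry_src (se i) (mpM (me i)) h.
have fv i : f (s i) * v i = v i by have [_ _ h] := hv i; exact: isometry_tgt (sf _) (mpM (mf _)) h.
have vf i : star (v i) * f (s i) = star (v i) by rewrite -[f _ in LHS]sf -starM fv.
have ev i : e i * star (v i) = star (v i) by rewrite -[e _ in LHS]se -starM ve.
pose w := \sum_i v i.
have conj (x : 'I_N -> R[i]) : w * (\sum_i x i *: e i) * star w = \sum_i x i *: f (s i).
  rewrite /w star_sum !mulr_suml; apply: eq_bigr => i _.
  have -> : v i * (\sum_k x k *: e k) = x i *: v i.
    rewrite mulr_sumr (bigD1 i)//= -cscalerAr ve big1 ?addr0// => k ki.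
    by rewrite -cscalerAr -(ve i) -mulrA ee eq_sym (negbTE ki) mulr0 scaler0.
  rewrite mulr_sumr (bigD1 i)//= -cscalerAl; have [_ _ ->] := hv i.
  rewrite big1 ?addr0// => k ki.
  by rewrite -cscalerAl -(ve i) -(ev k) -mulrA (mulrA (e i)) ee eq_sym (negbTE ki) mul0r mulr0 scaler0.
exists w.
  split.
    rewrite /w star_sum mulr_suml -e1; apply: eq_bigr => i _.
    rewrite mulr_sumr (bigD1 i)//=; have [_ -> _] := hv i; rewrite big1 ?addr0// => k ki.
    by rewrite -(vf i) -(fv k) -mulrA (mulrA (f _)) ff (inj_eq si) eq_sym (negbTE ki) mul0r mulr0.
  have := conj (fun=> 1); under eq_bigr do rewrite scale1r; rewrite e1 mulr1 => ->.
  by under eq_bigr do rewrite scale1r; rewrite -reS.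
rewrite conj (reS (fun j => m j *: f j)) -sumrB.
under eq_bigr do rewrite -scalerBl.
have pfs : pvm B (fun i => f (s i)).
  by split=> // [i j|]; rewrite ?ff ?(inj_eq si)// -reS.
exact: (pvm_norm pfs).
Qed.

End Matching.

(** * Bump functions on the circle *)

Section Bump.
Variable R : realType.
Local Notation T := (@circle R).
Local Notation CT := (C_circle R).

(** Each [h k] is a tent, at least 1 within [d] of [z k] and zero from distance [2 * d] on; [g] is
    the sum of the tents over [J], truncated at 1. *)
Lemma circle_bump K (z : 'I_K -> T) (d : R) (J : {set 'I_K}) : 0 < d ->
  exists g : CT, [/\ forall x, normc (g x) <= 1,
    forall x k, k \in J -> normc (val x - val (z k)) <= d -> g x = 1 &
    forall x, g x != 0 -> exists2 k, k \in J & normc (val x - val (z k)) < 2 * d].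
Proof.
move=> d0.
pose h (k : 'I_K) (x : T) : R := Num.max 0 (2 - normc (val x - val (z k)) / d).
have ch k : continuous (h k).
  have c1 : continuous (fun x : T => normc ((idC R - cscale (val (z k)) 1) x)).
    exact: normc_comp_continuous.
  have c1E x : (idC R - cscale (val (z k)) 1) x = val x - val (z k).
    by change (val x - val (z k) * 1 = val x - val (z k)); rewrite mulr1.
  move=> x; apply: (@continuous_max R T (fun=> 0) (fun x => 2 - normc (val x - val (z k)) / d)).
    exact: cst_continuous.
  have -> : (fun x : T => 2 - normc (val x - val (z k)) / d : R^o) =
      (fun x => 2 - normc ((idC R - cscale (val (z k)) 1) x) / d).
    by apply/funext => y; rewrite c1E.
  exact: (cvgB (@cst_continuous _ _ (2 : R) x) (cvgM (c1 x) (@cst_continuous _ _ (d^-1) x))).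
pose G : CT := \sum_(k in J) realC (ch k).
have h0 k x : 0 <= h k x by rewrite /h le_max lexx.
have GE x : normc (G x) = \sum_(k in J) h k x.
  rewrite C_sumE (eq_bigr (fun k => (h k x)%:C))// -(rmorph_sum (real_complex R)) normc_real.
  by rewrite ger0_norm// sumr_ge0.
have cg : continuous (fun x => Num.min 1 (normc (G x))).
  move=> x; apply: (@continuous_min R T (fun=> 1) (fun x => normc (G x))).
    exact: cst_continuous.
  exact: normc_comp_continuous.
have gE x : realC cg x = (Num.min 1 (\sum_(k in J) h k x))%:C by rewrite -GE.
have sum0 x : 0 <= \sum_(k in J) h k x by rewrite sumr_ge0.
exists (realC cg); split=> x.
- by rewrite gE normc_real ger0_norm ?le_min ?sum0 ?ler01// ge_min lexx.
- move=> k kJ xk; rewrite gE min_l ?rmorph1//.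
  rewrite (bigD1 k)//= ler_wpDr ?sumr_ge0//.
  rewrite /h le_max; apply/orP; right.
  have : normc (val x - val (z k)) / d <= 1 by rewrite ler_pdivrMr// mul1r.
  by lra.
rewrite gE => g0; apply: contrapT => hn.
move: g0; rewrite big1 ?min_r ?ler01 ?eqxx// => k kJ.
rewrite /h max_l// subr_le0 ler_pdivlMr// leNgt; apply/negP => xk.
by apply: hn; exists k.
Qed.

End Bump.

(** * The theorem *)

(** The inverse of 1 plus the sum of the inverses; the summand 1 covers an empty [I]. *)
Lemma fin_pos_lb (R : realFieldType) (I : finType) (d : I -> R) : (forall i, 0 < d i) ->
  exists2 m, 0 < m & forall i, m <= d i.
Proof.
move=> d0; have S0 : 0 <= \sum_i (d i)^-1 by apply: sumr_ge0 => i _; rewrite invr_ge0 ltW.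
have S1 : 0 < 1 + \sum_i (d i)^-1 by rewrite ltr_wpDr.
exists (1 + \sum_i (d i)^-1)^-1 => [|i]; first by rewrite invr_gt0.
rewrite -[leRHS]invrK lef_pV2 ?posrE ?invr_gt0// (bigD1 i)//= addrCA lerDl.
by rewrite addr_ge0// sumr_ge0// => j _; rewrite invr_ge0 ltW.
Qed.

Section AFApproximation.
Variables (R : realType) (A : cstarAlgType R).

Lemma closure_cnorm (D : set A) (x : A) (e : R) : closure D = [set: A] -> 0 < e ->
  exists2 y, D y & cnorm (y - x) < e.
Proof.
move=> hD e0; have : closure D x by rewrite hD.
move=> /(_ (ball x e%:C)) [|y [Dy]].
  by apply: nbhsx_ballx; rewrite -[0]/(0%:C) ltcR.
rewrite -ball_normE /= => h; exists y => //.
by move: h; rewrite -[`|_|]/((cnorm (x - y))%:C) ltcR cnormBC.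
Qed.

Lemma AF_approx (B : nat -> set A) (I : finType) (x : I -> A) (e : R) :
  (forall n, B n `<=` B n.+1) -> closure (\bigcup_n B n) = [set: A] -> 0 < e ->
  exists N, forall n, (N <= n)%N -> forall i, exists2 y, B n y & cnorm (y - x i) < e.
Proof.
move=> incB clB e0.
have mono m n : (m <= n)%N -> B m `<=` B n.
  by elim: n => [|n IH]; rewrite leq_eqVlt => /predU1P[->//|//] /IH h y /h /incB.
have /choice[k hk] : forall i, exists n, exists2 y, B n y & cnorm (y - x i) < e.
  by move=> i; have [y [n _ By] xy] := closure_cnorm (x i) clB e0; exists n, y.
exists (\max_i k i) => n kn i; have [y By xy] := hk i; exists y => //.
by apply: (mono (k i)) => //; apply: leq_trans kn; exact: leq_bigmax.
Qed.

End AFApproximation.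

Section Main.
Variables (R : realType) (A : cstarAlgType R).
Local Notation T := (@circle R).
Local Notation CT := (C_circle R).
Local Notation z0 := (idC R).

Lemma starhom_unitary (phi : CT -> A) : is_starhom phi -> unitary (phi z0).
Proof.
move=> h; have zz (x : T) : (val x)^* * val x = 1 :> R[i].
  by rewrite -normc_sqE circle_normc expr1n rmorph1.
split; rewrite -(shS h) -(shM h) -(sh1 h); congr (phi _); apply: C_eq => x.
  by change ((val x)^* * val x = 1).
by change (val x * (val x)^* = 1); rewrite mulrC.
Qed.

Lemma unitary_spectral (B : set A) (w : A) : star_subalgebra B -> fin_dim B -> B 1 ->
  B w -> unitary w ->
  exists N (e : 'I_N -> A) (l : 'I_N -> T), [/\ pvm B e, forall i, minproj B (e i) &
    w = \sum_i (val (l i) : R[i]) *: e i].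
Proof.
move=> hB fB B1 Bw [w1 w2].
have [N [e [l [pe e0 wE _]]]] := spectral_theorem hB fB B1 Bw (etrans w1 (esym w2)).
have lc i : normc (l i) = 1.
  have we : w * e i = l i *: e i by rewrite [in LHS]wE (pvm_mulr pe).
  have [_ se ee _] := pe.
  have ne : cnorm (e i) = 1 by apply: proj_cnorm1; rewrite ?se ?ee ?eqxx.
  have : cnorm (w * e i) ^+ 2 = 1.
    by rewrite -cnorm_starM starM -mulrA (mulrA (star w)) w1 mul1r se ee eqxx ne.
  rewrite we cnormS ne mulr1 => /eqP; rewrite sqrf_eq1 => /orP[/eqP//|/eqP h].
  by have := normc_ge0 (l i); rewrite h; lra.
have /choice[m hm] : forall i, exists z : T, val z = l i.
  move=> i; have lT : l i \in @circle R by apply/mem_set; rewrite /circle /= normcE lc.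
  by exists (exist _ (l i) lT).
have [N' [e' [l' [pe' me' sumE]]]] := pvm_refine hB fB m pe e0.
exists N', e', l'; split=> //; rewrite (sumE (fun z => val z)) wE.
by apply: eq_bigr => i _; rewrite hm.
Qed.

(** Telescoping: exchanging the two outer factors costs t (C + 1) and C t, exchanging [y] for [x]
    costs C^2 s, then come the given 1/4 and the distance s from [b] to [a]. *)
Lemma conj_perturb (r r' x y a b : A) (C t s : R) : cnorm r <= C -> cnorm (r' - r) <= t -> t <= 1 ->
  cnorm y <= 1 -> cnorm (y - x) <= s -> cnorm (a - b) <= s -> cnorm (r * x * star r - b) <= 1 / 4 ->
  cnorm (r' * y * star r' - a) <= t * (2 * C + 1) + C ^+ 2 * s + 1 / 4 + s.
Proof.
move=> rC rt t1 y1 yx ab hr.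
have -> : r' * y * star r' - a = (r' - r) * y * star r' + r * y * star (r' - r) +
    r * (y - x) * star r + (r * x * star r - b) + (b - a).
  rewrite !(starB, mulrBr, mulrBl) !addrA.
  by rewrite !(subrK, addrNK).
have r'C : cnorm r' <= C + 1.
  by have := cnormD (r' - r) r; rewrite subrK; lra.
have C0 : 0 <= C := le_trans (cnorm_ge0 _) rC.
have mul3 (p q v : A) (P Q V : R) : cnorm p <= P -> cnorm q <= Q -> cnorm v <= V ->
    cnorm (p * q * star v) <= P * Q * V.
  move=> hp hq hv; apply: le_trans (cnormM _ _) _; rewrite cnorm_star.
  apply: ler_pM => //; rewrite ?cnorm_ge0//; apply: le_trans (cnormM _ _) _.
  by apply: ler_pM => //; rewrite cnorm_ge0.
have h1 := mul3 _ _ _ _ _ _ rt y1 r'C.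
have h2 := mul3 _ _ _ _ _ _ rC y1 rt.
have h3 := mul3 _ _ _ _ _ _ rC yx rC.
move: h1 h2 h3 hr; rewrite cnormBC in ab; move: ab; clear.
set X1 := _ * star r'; set X2 := _ * star (_ - _); set X3 := _ * star r; set X4 := _ - b.
have := cnormD (X1 + X2 + X3 + X4) (b - a); have := cnormD (X1 + X2 + X3) X4.
have := cnormD (X1 + X2) X3; have := cnormD X1 X2.
move: (cnorm X1) (cnorm X2) (cnorm X3) (cnorm X4) (cnorm (b - a)) (cnorm _) (cnorm _) (cnorm _)
  (cnorm _) => *; lra.
Qed.

Variables (phi_u phi_v : unital_starhom CT A).
Hypothesis AF : AF_algebra A.
Hypothesis CuE : forall a : infmx CT, stab_pos a -> Cu_map phi_u a = Cu_map phi_v a.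

Lemma approx_conjugate (eps : R) : 0 < eps ->
  exists2 w : A, unitary w & cnorm (w * phi_u z0 * star w - phi_v z0) < eps.
Proof.
move=> eps0; have hu := unital_starhomP phi_u; have hv := unital_starhomP phi_v.
(* Matched eigenvalues will differ by at most [3 * d], half of [eps]; replacing the two unitaries by
   diagonal ones costs at most [eps / 8] each. *)
pose d := eps / 6; have d0 : 0 < d by rewrite divr_gt0.
have [s hs] := circle_net d0.
pose K := size s; pose z (k : 'I_K) := tnth (in_tuple s) k.
have hz (x : T) : exists k, normc (val x - val (z k)) < d.
  have [y ys xy] := hs x; have ik : (index y s < K)%N by rewrite index_mem.
  by exists (Ordinal ik); rewrite /z (tnth_nth y) /= nth_index.
have /choice[g hg] := fun J : {set 'I_K} => circle_bump z J d0.
(* The square has the form [star x * x] required by [stab_pos_emb], and inherits from [g J] the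
   places where it is 1 and where it vanishes. *)
pose f J := star (g J) * g J.
have fE J x : f J x = (g J x)^* * g J x by [].
have f1 J x : normc (f J x) <= 1.
  have [g1 _ _] := hg J; rewrite fE normcM normcJE -[leRHS]mulr1.
  by rewrite ler_pM ?normc_ge0.
have /choice[r hr] : forall J, exists r : A,
    cnorm (r * phi_v (f J) * star r - phi_u (f J)) < 1 / 4.
  move=> J; apply: Cu_map_cuntz; last by rewrite divr_gt0.
  by apply: CuE; exact: stab_pos_emb.
pose C := 1 + \sum_J cnorm (r J).
have C1 : 1 <= C by rewrite lerDl sumr_ge0// => J _; exact: cnorm_ge0.
have rC J : cnorm (r J) <= C.
  rewrite /C (bigD1 J)//= addrCA lerDl addr_ge0// sumr_ge0// => J' _; exact: cnorm_ge0.
(* With [tau] below, the four terms of [conj_perturb] are at most 1/4, 1/8, 1/4 and 1/8, with sum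
   below 1 as [comparison_card] demands. *)
pose tol := (8 * C ^+ 2)^-1; have C0 : 0 < C := lt_le_trans ltr01 C1.
have tol0 : 0 < tol by rewrite invr_gt0 mulr_gt0// exprn_gt0.
have /choice[dl hdl] : forall J, exists dl : R, 0 < dl /\ forall phi psi : CT -> A,
    is_starhom phi -> is_starhom psi -> cnorm (phi z0 - psi z0) < dl ->
    cnorm (phi (f J) - psi (f J)) < tol.
  by move=> J; have [e e0 he] := calc_cont_all A (f J) tol0; exists e.
have [dmin dmin0 hdmin] := fin_pos_lb (fun J => (hdl J).1).
(* The bound 1/20 is the hypothesis of [unitary_approx], whose error [8 * eta] is then at most
   [eps / 8] and [dmin / 2]. *)
pose eta := Num.min (1 / 20) (Num.min (eps / 64) (dmin / 16)).
have eta0 : 0 < eta by rewrite !lt_min !divr_gt0.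
have eta1 : eta <= 1 / 20 by rewrite ge_min lexx.
have eta2 : eta <= eps / 64 by rewrite !ge_min lexx orbT.
have eta3 : eta <= dmin / 16 by rewrite !ge_min lexx !orbT.
pose tau := (4 * (2 * C + 1))^-1.
have tau0 : 0 < tau by rewrite invr_gt0; lra.
have [Bn [BnP incB clB]] := AF.
have [n1 hn1] := AF_approx r incB clB tau0.
have [n2 hn2] := AF_approx (fun b : bool => if b then phi_u z0 else phi_v z0) incB clB eta0.
have [n3 hn3] := AF_approx (fun _ : unit => 1) incB clB (ltr01 : 0 < 1 :> R).
pose n := maxn n1 (maxn n2 n3).
have [hB fB] := BnP n; set B := Bn n in hB fB.
have n1n : (n1 <= n)%N by rewrite leq_maxl.
have n2n : (n2 <= n)%N by rewrite !leq_max leqnn orbT.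
have n3n : (n3 <= n)%N by rewrite !leq_max leqnn !orbT.
(* The subalgebras of the AF filtration may have another unit or none; an element at distance below
   1 from 1 forces 1 into [B]. *)
have B1 : B 1.
  have [y By y1] := hn3 n n3n tt; apply: (fin_dim_unit hB fB By).
  by rewrite cnormBC.
have approx (phi : CT -> A) x : is_starhom phi -> B x -> cnorm (x - phi z0) < eta ->
    exists N (e : 'I_N -> A) (l : 'I_N -> T), [/\ pvm B e, forall i, minproj B (e i),
      cnorm (\sum_i (val (l i) : R[i]) *: e i - phi z0) <= 8 * eta &
      forall J, cnorm (\sum_i f J (l i) *: e i - phi (f J)) <= tol].
  move=> h Bx /ltW xe.
  have [w [Bw uw wphi]] := unitary_approx hB fB B1 (starhom_unitary h) Bx xe eta1.
  have [N [e [l [pe me wE]]]] := unitary_spectral hB fB B1 Bw uw.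
  exists N, e, l; split=> //; first by rewrite -wE.
  move=> J; apply: ltW; apply: ((hdl J).2 (fun f : CT => \sum_i f (l i) *: e i) phi (pvm_starhom pe l) h).
  change (cnorm (\sum_i (val (l i) : R[i]) *: e i - phi z0) < dl J).
  rewrite -wE; apply: le_lt_trans wphi _; apply: lt_le_trans (hdmin J).
  by lra.
have [xu Bxu hxu] := hn2 n n2n true; have [xv Bxv hxv] := hn2 n n2n false.
have [N [e [l [pe me ue uf]]]] := approx _ _ hu Bxu hxu.
have [M [p [m [pp mp vp vf]]]] := approx _ _ hv Bxv hxv.
have [|sg [si hsg]] := @pvm_matching _ _ B hB fB B1 N M e p
    (fun i j => normc (val (l i) - val (m j)) <= 3 * d) pe pp me mp.
  move=> S /finset.set0Pn[i0 i0S].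
  (* Net points within [d] of an eigenvalue indexed by [S]: [f J] is 1 at those eigenvalues, and
     where it is nonzero a point of [J] lies within [2 * d], which gives closeness [3 * d]. *)
  pose J := [set k | [exists i in S, normc (val (l i) - val (z k)) <= d]]%SET.
  have [r' Br' rr'] := hn1 n n1n J; have [_ gd gs] := hg J.
  exists (fun i => f J (l i)), (fun j => f J (m j)), r'; split=> //.
  - have h1 : cnorm (\sum_j f J (m j) *: p j) <= 1 by apply: (pvm_norm pp).
    have t1 : tau <= 1.
      by rewrite -[leRHS]invr1 lef_pV2 ?posrE//; lra.
    apply: le_lt_trans (conj_perturb (rC J) (ltW rr') t1 h1 (vf J) (uf J) (ltW (hr J))) _.
    have -> : tau * (2 * C + 1) = 1 / 4.
      have ne : 2 * C + 1 != 0 by rewrite gt_eqF//; lra.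
      by rewrite /tau invfM -mulrA mulVf// mulr1 mul1r.
    have -> : C ^+ 2 * tol = 1 / 8.
      have ne : C ^+ 2 != 0 by rewrite expf_eq0 gt_eqF.
      by rewrite /tol invfM mulrCA mulfV// mulr1 mul1r.
    have : tol <= 1 / 8.
      rewrite /tol div1r lef_pV2 ?posrE// ?mulr_gt0 ?exprn_gt0//.
      by have : 1 <= C ^+ 2 by [rewrite exprn_ege1|]; lra.
    lra.
  - move=> i iS; have [k hk] := hz (l i).
    rewrite fE (gd (l i) k) ?(ltW hk)//; last first.
      by rewrite inE; apply/exists_inP; exists i => //; exact: ltW.
    by rewrite mulr1; exact: conjc1.
  - move=> j; rewrite fE mulf_eq0 negb_or => /andP[_ /gs[k kJ kd]].
    move: kJ; rewrite inE => /exists_inP[i iS ik]; exists i => //.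
    rewrite -(subrKA (val (z k))); apply: le_trans (normc_triangle _ _) _.
    by rewrite normcBC in kd; lra.
have d3 : 0 <= 3 * d by lra.
have [w uw hw] := @matched_unitary _ _ B hB fB B1 N M e p sg (fun i => val (l i))
    (fun j => val (m j)) (3 * d) pe pp me mp si (fun i => (hsg i).1) d3 (fun i => (hsg i).2).
exists w => //; move: hw ue vp; set u' := \sum_i _; set v' := \sum_j _ => hw ue vp.
have := cnorm_tri (w * phi_u z0 * star w) (w * u' * star w) (phi_v z0).
have := cnorm_tri (w * u' * star w) v' (phi_v z0).
have := cnorm_unitary_mul (phi_u z0 - u') uw.
rewrite mulrBr mulrBl (cnormBC (phi_u z0)) => h1 h2 h3.
apply: le_lt_trans h3 _; have d6 : d = eps / 6 by [].
lra.
Qed.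

End Main.

Theorem theorem1p2 (R : realType) (A : cstarAlgType R)
    (phi_u phi_v : unital_starhom (C_circle R) A) :
  AF_algebra A ->
  (forall a : infmx (C_circle R),
     stab_pos a -> Cu_map phi_u a = Cu_map phi_v a) ->
  approx_unitarily_equivalent phi_u phi_v.
Proof.
move=> AF CuE.
have /choice[w hw] : forall n : nat, exists w : A, unitary w /\
    cnorm (w * phi_u (idC R) * star w - phi_v (idC R)) < n.+1%:R^-1.
  move=> n; have n0 : 0 < n.+1%:R^-1 :> R by [].
  by have [w uw h] := approx_conjugate AF CuE n0; exists w.
exists w; split=> [n|x]; first by have [] := hw n.
(* Conjugating the generator suffices: [d] depends only on [x] and [e], so one sequence [w] serves
   every [x]. *)
apply/cvgrPdist_lt => e e0; have [d d0 hd] := calc_cont_all A x e0.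
have := @cvg_harmonic R => /cvgrPdist_lt /(_ d d0); apply: filterS => n /=.
rewrite !sub0r !normrN !ger0_norm ?cnorm_ge0 ?invr_ge0// => nd.
have [uw wn] := hw n.
apply: (hd (fun x => w n * phi_u x * star (w n)) phi_v).
- exact: (starhom_conj (unital_starhomP phi_u)).
- exact: unital_starhomP.
- exact: lt_trans wn nd.
Qed.
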